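(* Let $f$ be a transcendental entire function, let $z_0 \in \mathbb{C}$ with $f(z_0) \neq 0$, and let $$F(z) = \int_{z_0}^{z} \frac{du}{f(u)},$$ defined on a neighbourhood of $z_0$; since $F'(z_0) = 1/f(z_0) \neq 0$, $F$ maps a neighbourhood of $z_0$ conformally onto a neighbourhood of $0$, and $F^{-1}$ denotes this local inverse. Let $\delta>0$ be sufficiently small that $F^{-1}(iy)$ is defined for all $y \in (-\delta,\delta)$. Let $Y_\delta$ be the set of $y \in (-\delta,\delta)$ such that the trajectory of the flow $\dot z = f(z)$ starting at $F^{-1}(iy)$ tends to infinity in finite increasing time. Then $Y_\delta$ has Lebesgue measure $0$.
   Context: A trajectory of the flow $\dot z = f(z)$ is a path $z(t)$ in the plane with $z'(t) = f(z(t)) \in \mathbb{C}$ for $t$ in a maximal interval $(\alpha,\beta) \subseteq \mathbb{R}$; the trajectory starting at $w$ is the one with $z(0)=w$. It tends to infinity in finite increasing time if $\beta \in \mathbb{R}$ (i.e. $\beta<+\infty$) and $z(t)\to\infty$ as $t \to \beta^-$. *)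

(* Defs.v *)
From Stdlib Require Import Reals List.
From Coquelicot Require Import Coquelicot.
Open Scope R_scope.

Definition has_cderiv (f : C -> C) (z l : C) : Prop :=
  @is_derive C_AbsRing C_NormedModule f z l.

Definition entire (f : C -> C) : Prop :=
  forall z : C, @ex_derive C_AbsRing C_NormedModule f z.

Definition poly_eval (l : list C) (z : C) : C :=
  fold_right (fun a acc => Cplus a (Cmult z acc)) (RtoC 0) l.

Definition is_polynomial_fun (f : C -> C) : Prop :=
  exists l : list C, forall z : C, f z = poly_eval l z.

Definition transcendental_entire (f : C -> C) : Prop :=
  entire f /\ ~ is_polynomial_fun f.

Definition solves_flow (f : C -> C) (z : R -> C) (a b : R) : Prop :=
  forall t : R, a < t < b ->
    @is_derive R_AbsRing C_R_NormedModule z t (f (z t)).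

(** The trajectory of dz/dt = f(z) starting at w tends to infinity in finite
    increasing time: there is a finite beta > 0 and a solution on an interval
    (alpha, beta) containing 0 with z(0) = w and |z(t)| -> +oo as t -> beta^-.
    (Since f is entire, hence locally Lipschitz, solutions are unique, so this
    solution is the restriction of the maximal trajectory starting at w, and
    beta is the right end of its maximal interval.) *)
Definition escapes_in_finite_time (f : C -> C) (w : C) : Prop :=
  exists (alpha beta : R) (z : R -> C),
    alpha < 0 < beta /\ z 0 = w /\ solves_flow f z alpha beta /\
    (forall M : R, exists eta : R, 0 < eta /\
       forall t : R, beta - eta < t < beta -> M < Cmod (z t)).

From mathcomp Require Import all_boot all_algebra.
From mathcomp Require Import all_classical all_reals all_analysis.
From mathcomp Require Import Rstruct Rstruct_topology.

Definition lebesgue_null (Y : Stdlib.Reals.Rdefinitions.R -> Prop) : Prop :=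
  (@lebesgue_measure Stdlib.Reals.Rdefinitions.R).-negligible Y.

(* Main.v *)
(** The plane is parabolic, and this forbids a set of positive measure of trajectories from
    reaching infinity in bounded time; the argument is a discrete form of the length-area method.

    Consider the trajectories that start on a compact arc of the transversal [G] and blow up
    before time [N].  Cut the plane into [P = Q J] layers between the squares of half-side
    [rho0 exp (i / J)].  Each trajectory crosses all layers in total time at most [N], so at
    least half of its crossings last at most [2 N / P], and such a crossing starts at a point
    where [|f|] is at least a constant times [rho_i Q / N].  Divide the boundary of each square
    into O(J) cells.  The map [F], whose derivative is [1 / f], turns trajectories into
    horizontal lines, so trajectories hitting the same cell fast at nearby times started at
    parameters [y] that are O(1 / P) apart.  Since a trajectory needs a definite time to leave
    the domain of [F] and come back to the arc, boundedly many time slabs suffice, and each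
    layer has a set of [y]'s of measure O(J / P) = O(1 / Q) that cross it fast.  As every [y] in
    question is in at least half of these sets, they form a set of measure O(1 / Q), for every
    [Q].  (The cells are taken small after [Q] is fixed.)

    The comparison of trajectories requires [f] to be uniformly differentiable on compact sets,
    which is obtained from Goursat's theorem and Cauchy's formula on squares. *)

Require Import Defs.
From Stdlib Require Import Reals.
From Coquelicot Require Import Coquelicot.
From Stdlib Require Import Lra Lia List Classical ClassicalEpsilon.
Open Scope R_scope.

(** * Derivatives of complex-valued functions *)

(** The domination clause of [is_derive] quantifies over all points to which [locally x] converges.
    The only such point is [x], so the clause reduces to one remainder estimate, the form in which
    derivatives are handled below. *)
Lemma is_derive_eps (K : AbsRing) (V : NormedModule K) (f : K -> V) (x : K) (l : V) :
  is_derive f x l <->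
  forall eps : posreal, locally x (fun y =>
    norm (minus (minus (f y) (f x)) (scal (minus y x) l)) <= eps * norm (minus y x)).
Proof.
  split.
  - intros [_ H] eps.
    assert (Hx : is_filter_lim (locally x) x) by (intros P HP; exact HP).
    exact (H x Hx eps).
  - intros H; split.
    + apply is_linear_scal_l.
    + intros y Hy.
      rewrite <- (is_filter_lim_locally_unique x y Hy).
      intros eps; exact (H eps).
Qed.

Lemma C_ball_Cmod (z w : C) (d : R) : Cmod (w - z) < d -> ball z d w.
Proof. intros H. apply C_NormedModule_mixin_compat1. exact H. Qed.

(** Balls of [C] come from the product structure, so passing to the modulus costs a factor [sqrt 2],
    here rounded up to 2. *)
Lemma Cmod_C_ball (z w : C) (d : posreal) : ball z d w -> Cmod (w - z) < 2 * d.
Proof.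
  intros H. apply C_NormedModule_mixin_compat2 in H.
  change (minus w z) with (w - z)%C in H.
  assert (sqrt 2 < 2).
  { rewrite <- (sqrt_square 2) at 2 by lra. apply sqrt_lt_1; lra. }
  pose proof (cond_pos d). nra.
Qed.

Lemma locally_Cmod (z : C) (P : C -> Prop) :
  locally z P <-> exists d, 0 < d /\ forall w, Cmod (w - z) < d -> P w.
Proof.
  split.
  - intros [d Hd]. exists d; split; [apply cond_pos|].
    intros w Hw. apply Hd. now apply C_ball_Cmod.
  - intros [d [Hd H]]. assert (H2 : 0 < d / 2) by lra.
    exists (mkposreal _ H2). intros w Hw. apply H.
    apply Cmod_C_ball in Hw. simpl in Hw. lra.
Qed.

Lemma has_cderiv_eps (f : C -> C) (z l : C) :
  has_cderiv f z l <->
  forall eps, 0 < eps -> exists d, 0 < d /\ forall w, Cmod (w - z) < d ->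
    Cmod (f w - f z - (w - z) * l) <= eps * Cmod (w - z).
Proof.
  unfold has_cderiv. rewrite is_derive_eps. split.
  - intros H eps He. destruct (H (mkposreal _ He)) as [d Hd].
    exists d; split; [apply cond_pos|]. intros w Hw. exact (Hd w Hw).
  - intros H eps. destruct (H eps (cond_pos eps)) as [d [Hd Hd2]].
    exists (mkposreal _ Hd). intros w Hw. exact (Hd2 w Hw).
Qed.

Lemma is_derive_R_eps (f : R -> R) (x l : R) :
  is_derive f x l <->
  forall eps, 0 < eps -> exists d, 0 < d /\ forall y, Rabs (y - x) < d ->
    Rabs (f y - f x - (y - x) * l) <= eps * Rabs (y - x).
Proof.
  rewrite is_derive_eps. split.
  - intros H eps He. destruct (H (mkposreal _ He)) as [d Hd].
    exists d; split; [apply cond_pos|]. intros y Hy. exact (Hd y Hy).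
  - intros H eps. destruct (H eps (cond_pos eps)) as [d [Hd Hd2]].
    exists (mkposreal _ Hd). intros y Hy. exact (Hd2 y Hy).
Qed.

(** Working by coordinates gives access to the rules and the mean value theorem for real functions;
    [rder_eps] recovers the estimate in [Cmod]. *)
Definition rder (z : R -> C) (t : R) (v : C) : Prop :=
  is_derive (fun s => fst (z s)) t (fst v) /\ is_derive (fun s => snd (z s)) t (snd v).

Lemma Cmod_le_add (z : C) : Cmod z <= Rabs (fst z) + Rabs (snd z).
Proof.
  rewrite <- (Rabs_pos_eq (Rabs (fst z) + Rabs (snd z))).
  2:{ pose proof (Rabs_pos (fst z)); pose proof (Rabs_pos (snd z)); lra. }
  rewrite <- sqrt_Rsqr_abs. apply sqrt_le_1_alt. unfold Rsqr.
  pose proof (Rabs_pos (fst z)); pose proof (Rabs_pos (snd z)).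
  rewrite <- (pow2_abs (fst z)), <- (pow2_abs (snd z)). nra.
Qed.

Lemma Rabs_fst_le (z : C) : Rabs (fst z) <= Cmod z.
Proof. eapply Rle_trans; [|apply Rmax_Cmod]. apply Rmax_l. Qed.

Lemma Rabs_snd_le (z : C) : Rabs (snd z) <= Cmod z.
Proof. eapply Rle_trans; [|apply Rmax_Cmod]. apply Rmax_r. Qed.

Lemma rder_eps (z : R -> C) (t : R) (v : C) :
  rder z t v <->
  forall eps, 0 < eps -> exists d, 0 < d /\ forall s, Rabs (s - t) < d ->
    Cmod (z s - z t - RtoC (s - t) * v) <= eps * Rabs (s - t).
Proof.
  assert (E1 : forall s, fst (z s - z t - RtoC (s - t) * v)%C
    = fst (z s) - fst (z t) - (s - t) * fst v) by (intros; simpl; ring).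
  assert (E2 : forall s, snd (z s - z t - RtoC (s - t) * v)%C
    = snd (z s) - snd (z t) - (s - t) * snd v) by (intros; simpl; ring).
  unfold rder. rewrite !is_derive_R_eps. split.
  - intros [H1 H2] eps He.
    destruct (H1 (eps / 2)) as [d1 [Hd1 K1]]; [lra|].
    destruct (H2 (eps / 2)) as [d2 [Hd2 K2]]; [lra|].
    exists (Rmin d1 d2); split; [now apply Rmin_pos|]. intros s Hs.
    eapply Rle_trans; [apply Cmod_le_add|]. rewrite E1, E2.
    pose proof (Rmin_l d1 d2); pose proof (Rmin_r d1 d2).
    specialize (K1 s ltac:(lra)). specialize (K2 s ltac:(lra)). lra.
  - intros H; split; intros eps He; destruct (H eps He) as [d [Hd K]];
      exists d; (split; [assumption|]); intros s Hs; specialize (K s Hs).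
    + rewrite <- E1. eapply Rle_trans; [apply Rabs_fst_le|exact K].
    + rewrite <- E2. eapply Rle_trans; [apply Rabs_snd_le|exact K].
Qed.

Lemma is_derive_rder (z : R -> C) (t : R) (v : C) :
  @is_derive R_AbsRing C_R_NormedModule z t v -> rder z t v.
Proof.
  rewrite is_derive_eps, rder_eps. intros H eps He.
  destruct (H (mkposreal _ He)) as [d Hd].
  exists d; split; [apply cond_pos|]. intros s Hs.
  specialize (Hd s Hs). simpl in Hd. rewrite <- Cmod_norm in Hd.
  replace (z s - z t - RtoC (s - t) * v)%C
    with (minus (minus (z s) (z t)) (scal (minus s t) v) : C); [exact Hd|].
  unfold minus, plus, opp, scal; simpl.
  unfold Cminus, Cplus, Copp, Cmult; simpl. apply injective_projections; simpl;
  unfold mult, minus, plus, opp, scal; simpl; unfold mult; simpl; ring.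
Qed.

Lemma rder_plus z w t v u : rder z t v -> rder w t u ->
  rder (fun s => z s + w s)%C t (v + u)%C.
Proof. intros [H1 H2] [H3 H4]; split; simpl; now apply @is_derive_plus. Qed.

Lemma rder_minus z w t v u : rder z t v -> rder w t u ->
  rder (fun s => z s - w s)%C t (v - u)%C.
Proof. intros [H1 H2] [H3 H4]; split; simpl; now apply @is_derive_minus. Qed.

Lemma rder_const c t : rder (fun _ => c) t 0%C.
Proof. split; simpl; apply @is_derive_const. Qed.

Lemma rder_RtoC t : rder RtoC t 1%C.
Proof. split; simpl; [apply @is_derive_id|apply @is_derive_const]. Qed.

Lemma rder_mult z w t v u : rder z t v -> rder w t u ->
  rder (fun s => z s * w s)%C t (v * w t + z t * u)%C.
Proof.
  intros [H1 H2] [H3 H4]; split; simpl.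
  - replace (_ + _) with (minus (plus (mult (fst v) (fst (w t))) (mult (fst (z t)) (fst u)))
      (plus (mult (snd v) (snd (w t))) (mult (snd (z t)) (snd u)))) by
      (unfold minus, plus, opp, mult; simpl; ring).
    apply @is_derive_minus; apply @is_derive_mult; auto; exact Rmult_comm.
  - replace (_ + _) with (plus (plus (mult (fst v) (snd (w t))) (mult (fst (z t)) (snd u)))
      (plus (mult (snd v) (fst (w t))) (mult (snd (z t)) (fst u)))) by
      (unfold minus, plus, opp, mult; simpl; ring).
    apply @is_derive_plus; apply @is_derive_mult; auto; exact Rmult_comm.
Qed.

Lemma Cmod_sqr (z : C) : Cmod z ^ 2 = fst z ^ 2 + snd z ^ 2.
Proof. rewrite Cmod2_alt. reflexivity. Qed.

Lemma rder_shift z t v a : rder z (t + a) v -> rder (fun s => z (s + a)) t v.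
Proof.
  rewrite !rder_eps. intros H eps He. destruct (H eps He) as [d [Hd K]].
  exists d; split; [assumption|]. intros s Hs.
  specialize (K (s + a)). replace (s + a - (t + a)) with (s - t) in K by ring. auto.
Qed.

Lemma rder_chain (h : C -> C) (z : R -> C) t l v :
  has_cderiv h (z t) l -> rder z t v -> rder (fun s => h (z s)) t (l * v)%C.
Proof.
  rewrite has_cderiv_eps, !rder_eps. intros Hh Hz eps He.
  (* As [e <= 1], [A] bounds both [Cmod l] and the Lipschitz quotient of [z] at [t]. Each of the two
     error terms is then at most [e * A * Rabs (s - t)], whence the requirement
     [e * (2 * A) <= eps]. *)
  set (A := Cmod l + Cmod v + 1 ).
  assert (HA : 1 <= A) by (unfold A; pose proof (Cmod_ge_0 l); pose proof (Cmod_ge_0 v); lra).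
  set (e := Rmin 1 (eps / (2 * A))).
  assert (He1 : 0 < e) by (apply Rmin_pos; [lra|apply Rdiv_lt_0_compat; lra]).
  assert (He2 : e * (2 * A) <= eps).
  { pose proof (Rmin_r 1 (eps / (2 * A))). fold e in H.
    apply Rmult_le_compat_r with (r := 2 * A) in H; [|lra]. field_simplify in H; lra. }
  assert (He3 : e <= 1) by apply Rmin_l.
  destruct (Hh e He1) as [d1 [Hd1 K1]].
  destruct (Hz e He1) as [d2 [Hd2 K2]].
  exists (Rmin d2 (d1 / A)); split; [apply Rmin_pos; [lra|apply Rdiv_lt_0_compat; lra]|].
  intros s Hs.
  pose proof (Rmin_l d2 (d1 / A)); pose proof (Rmin_r d2 (d1 / A)).
  specialize (K2 s ltac:(lra)).
  assert (B : Cmod (z s - z t) <= A * Rabs (s - t)).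
  { replace (z s - z t)%C with ((z s - z t - RtoC (s - t) * v) + RtoC (s - t) * v)%C by ring.
    eapply Rle_trans; [apply Cmod_triangle|]. rewrite Cmod_mult, Cmod_R.
    pose proof (Rabs_pos (s - t)). pose proof (Cmod_ge_0 l). unfold A. nra. }
  assert (B2 : Cmod (z s - z t) < d1).
  { eapply Rle_lt_trans; [exact B|].
    assert (Rabs (s - t) < d1 / A) by lra.
    apply Rmult_lt_compat_l with (r := A) in H1; [|lra]. field_simplify in H1; lra. }
  specialize (K1 _ B2).
  replace (h (z s) - h (z t) - RtoC (s - t) * (l * v))%C
    with ((h (z s) - h (z t) - (z s - z t) * l) + l * (z s - z t - RtoC (s - t) * v))%C by ring.
  eapply Rle_trans; [apply Cmod_triangle|]. rewrite Cmod_mult.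
  pose proof (Rabs_pos (s - t)). pose proof (Cmod_ge_0 l).
  assert (Cmod l <= A) by (unfold A; pose proof (Cmod_ge_0 v); lra).
  assert (e * Cmod (z s - z t) <= e * (A * Rabs (s - t))) by (apply Rmult_le_compat_l; lra).
  assert (Cmod l * Cmod (z s - z t - RtoC (s - t) * v) <= A * (e * Rabs (s - t)))
    by (apply Rmult_le_compat; auto; apply Cmod_ge_0).
  assert (e * (2 * A) * Rabs (s - t) <= eps * Rabs (s - t)) by (apply Rmult_le_compat_r; lra).
  nra.
Qed.

(** * Mean value inequality and Gronwall's inequality for plane curves *)

Lemma Cdot_le (z w : C) : Rabs (fst z * fst w + snd z * snd w) <= Cmod z * Cmod w.
Proof.
  assert (0 <= Cmod z * Cmod w) by (apply Rmult_le_pos; apply Cmod_ge_0).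
  rewrite <- (Rabs_pos_eq (Cmod z * Cmod w)) by assumption.
  apply Rsqr_le_abs_0. unfold Rsqr.
  replace (Cmod z * Cmod w * (Cmod z * Cmod w)) with (Cmod z ^ 2 * Cmod w ^ 2) by ring.
  rewrite !Cmod_sqr.
  pose proof (pow2_ge_0 (fst z * snd w - snd z * fst w)). nra.
Qed.

(** The real mean value theorem is applied to the scalar product of [z] with the fixed vector
    [z b - z a]; Cauchy-Schwarz then gives the bound. *)
Lemma rder_mean_value (z : R -> C) (v : R -> C) (a b K : R) :
  a <= b -> (forall t, a <= t <= b -> rder z t (v t)) ->
  (forall t, a <= t <= b -> Cmod (v t) <= K) ->
  Cmod (z b - z a) <= K * (b - a).
Proof.
  intros Hab Hd HK.
  set (w := (z b - z a)%C).
  set (h := fun t => fst w * fst (z t) + snd w * snd (z t)).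
  set (h' := fun t => fst w * fst (v t) + snd w * snd (v t)).
  assert (Hh : forall t, a <= t <= b -> is_derive h t (h' t)).
  { intros t Ht. destruct (Hd t Ht) as [H1 H2]. unfold h, h'.
    apply @is_derive_plus; apply is_derive_scal; assumption. }
  assert (E : h b - h a = Cmod w ^ 2).
  { rewrite Cmod_sqr. unfold h, w. simpl. ring. }
  destruct (MVT_gen h a b h') as [c [Hc Ec]].
  { intros x Hx. apply Hh. rewrite Rmin_left, Rmax_right in Hx; lra. }
  { intros x Hx. rewrite Rmin_left, Rmax_right in Hx by lra.
    apply continuity_pt_filterlim.
    apply (@ex_derive_continuous R_AbsRing R_NormedModule). exists (h' x). apply Hh. lra. }
  rewrite Rmin_left, Rmax_right in Hc by lra.
  rewrite E in Ec.
  assert (B : Rabs (h' c) <= Cmod w * Cmod (v c)) by apply Cdot_le.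
  pose proof (HK c Hc). pose proof (Cmod_ge_0 w). pose proof (Cmod_ge_0 (v c)).
  pose proof (Rle_abs (h' c)).
  assert (Cmod w ^ 2 <= Cmod w * (K * (b - a))).
  { rewrite Ec. apply Rle_trans with (Cmod w * Cmod (v c) * (b - a)).
    - apply Rmult_le_compat_r; lra.
    - rewrite <- Rmult_assoc. apply Rmult_le_compat_r; [lra|]. apply Rmult_le_compat_l; lra. }
  destruct (Req_dec (Cmod w) 0) as [Z|Z].
  - rewrite Z. apply Rmult_le_pos; lra.
  - apply Rmult_le_reg_l with (Cmod w); [lra|]. simpl in H3. lra.
Qed.

Lemma exp_weight_incr (p p' : R -> R) (a b k : R) :
  a <= b -> (forall t, a <= t <= b -> is_derive p t (p' t)) ->
  (forall t, a <= t <= b -> 0 <= p' t + k * p t) ->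
  exp (k * a) * p a <= exp (k * b) * p b.
Proof.
  intros Hab Hp Hk.
  assert (D : forall x, a <= x <= b ->
    is_derive (fun t => exp (k * t) * p t) x (exp (k * x) * (p' x + k * p x))).
  { intros x Hx.
    assert (He : is_derive (fun t => exp (k * t)) x (k * exp (k * x)))
      by (auto_derive; [trivial|ring]).
    replace (exp (k * x) * (p' x + k * p x)) with
      (plus (mult (k * exp (k * x)) (p x)) (mult (exp (k * x)) (p' x))) by
      (unfold plus, mult; simpl; ring).
    apply (is_derive_mult (fun t => exp (k * t)) p); auto; exact Rmult_comm. }
  destruct (MVT_gen (fun t => exp (k * t) * p t) a b
      (fun t => exp (k * t) * (p' t + k * p t))) as [c [Hc Ec]].
  - intros x Hx. rewrite Rmin_left, Rmax_right in Hx by lra. apply D; lra.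
  - intros x Hx. rewrite Rmin_left, Rmax_right in Hx by lra.
    apply continuity_pt_filterlim.
    apply (@ex_derive_continuous R_AbsRing R_NormedModule (fun t => exp (k * t) * p t)).
    eexists. apply D. lra.
  - rewrite Rmin_left, Rmax_right in Hc by lra.
    assert (0 <= exp (k * c) * (p' c + k * p c) * (b - a)).
    { apply Rmult_le_pos; [|lra]. apply Rmult_le_pos; [left; apply exp_pos|]. apply Hk; lra. }
    lra.
Qed.

(** The squared modulus [p] is differentiable even where [z] vanishes, and its derivative is at most
    [2 * K * p] in absolute value. Hence [p] times the exponential of [2 * K * t] increases, and [p]
    times that of [- 2 * K * t] decreases. *)
Lemma gronwall (z v : R -> C) (a b K : R) :
  a <= b -> (forall t, a <= t <= b -> rder z t (v t)) ->
  (forall t, a <= t <= b -> Cmod (v t) <= K * Cmod (z t)) ->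
  Cmod (z a) <= exp (K * (b - a)) * Cmod (z b) /\
  Cmod (z b) <= exp (K * (b - a)) * Cmod (z a).
Proof.
  intros Hab Hd HK.
  set (p := fun t => fst (z t) ^ 2 + snd (z t) ^ 2).
  set (p' := fun t => 2 * (fst (z t) * fst (v t) + snd (z t) * snd (v t))).
  assert (Hp : forall t, a <= t <= b -> is_derive p t (p' t)).
  { intros t Ht. destruct (Hd t Ht) as [H1 H2]. unfold p, p'.
    replace (2 * _) with (plus (INR 2 * fst (v t) * fst (z t) ^ pred 2) (INR 2 * snd (v t) * snd (z t) ^ pred 2))
      by (unfold plus; simpl; ring).
    apply @is_derive_plus; apply is_derive_pow; assumption. }
  assert (E : forall t, p t = Cmod (z t) * Cmod (z t)) by (intros t; unfold p; rewrite <- Cmod_sqr; ring).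
  assert (Bp : forall t, a <= t <= b -> - (2 * K * p t) <= p' t <= 2 * K * p t).
  { intros t Ht. specialize (HK t Ht). apply Rabs_le_between. rewrite E.
    unfold p'. rewrite Rabs_mult, (Rabs_pos_eq 2) by lra.
    pose proof (Cmod_ge_0 (z t)). pose proof (Cdot_le (z t) (v t)).
    assert (Cmod (z t) * Cmod (v t) <= Cmod (z t) * (K * Cmod (z t))) by (apply Rmult_le_compat_l; lra).
    lra. }
  assert (Sq : forall x y, 0 <= x -> 0 <= y -> x * x <= y * y -> x <= y).
  { intros x y Hx Hy H. apply Rsqr_incr_0_var; assumption. }
  assert (Ex : forall k x y, exp (k * a) * x <= exp (k * b) * y -> x <= exp (k * (b - a)) * y).
  { intros k x y G. apply Rmult_le_compat_l with (r := exp (- (k * a))) in G; [|left; apply exp_pos].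
    rewrite <- !Rmult_assoc, <- !exp_plus in G.
    replace (- (k * a) + k * a) with 0 in G by ring. rewrite exp_0 in G.
    replace (- (k * a) + k * b) with (k * (b - a)) in G by ring. lra. }
  assert (X : exp (K * (b - a)) * exp (K * (b - a)) = exp (2 * K * (b - a))) by
    (rewrite <- exp_plus; f_equal; ring).
  pose proof (Cmod_ge_0 (z a)); pose proof (Cmod_ge_0 (z b)).
  pose proof (exp_pos (K * (b - a))) as P.
  split.
  - apply Sq; [assumption|apply Rmult_le_pos; lra|].
    pose proof (Ex _ _ _ (exp_weight_incr p p' a b (2 * K) Hab Hp
      ltac:(intros t Ht; specialize (Bp t Ht); lra))) as G.
    rewrite !E, <- X in G. lra.
  - apply Sq; [assumption|apply Rmult_le_pos; lra|].
    (* The decreasing case is the increasing one for [- p] with weight [- (2 * K)]. *)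
    pose proof (exp_weight_incr (fun t => - p t) (fun t => - p' t) a b (- (2 * K)) Hab
      ltac:(intros t Ht; apply @is_derive_opp; auto)
      ltac:(intros t Ht; specialize (Bp t Ht); lra)) as G.
    apply Ex in G. rewrite !E in G.
    replace (- (2 * K) * (b - a)) with (- (2 * K * (b - a))) in G by ring.
    apply Rmult_le_compat_l with (r := exp (2 * K * (b - a))) in G; [|left; apply exp_pos].
    rewrite <- Rmult_assoc, <- exp_plus in G.
    replace (2 * K * (b - a) + - (2 * K * (b - a))) with 0 in G by ring.
    rewrite exp_0, <- X in G. lra.
Qed.

(** * Goursat's theorem on rectangles *)

Definition ccont (g : C -> C) (z : C) : Prop :=
  forall eps, 0 < eps -> exists d, 0 < d /\ forall w, Cmod (w - z) < d -> Cmod (g w - g z) < eps.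

Lemma ccont_minus g h z : ccont g z -> ccont h z -> ccont (fun w => g w - h w)%C z.
Proof.
  intros Hg Hh e He. destruct (Hg (e / 2)) as [d1 [D1 K1]]; [lra|].
  destruct (Hh (e / 2)) as [d2 [D2 K2]]; [lra|].
  exists (Rmin d1 d2); split; [now apply Rmin_pos|]. intros w Hw.
  pose proof (Rmin_l d1 d2); pose proof (Rmin_r d1 d2).
  specialize (K1 w ltac:(lra)). specialize (K2 w ltac:(lra)).
  replace (g w - h w - (g z - h z))%C with ((g w - g z) - (h w - h z))%C by ring.
  unfold Cminus at 1. eapply Rle_lt_trans; [apply Cmod_triangle|]. rewrite Cmod_opp. lra.
Qed.

Lemma has_cderiv_ccont f z l : has_cderiv f z l -> ccont f z.
Proof.
  rewrite has_cderiv_eps. intros H eps He.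
  destruct (H 1 Rlt_0_1) as [d [Hd K]].
  set (A := 1 + Cmod l). assert (HA : 0 < A) by (unfold A; pose proof (Cmod_ge_0 l); lra).
  exists (Rmin d (eps / A)); split; [apply Rmin_pos; [lra|now apply Rdiv_lt_0_compat]|].
  intros w Hw. pose proof (Rmin_l d (eps / A)); pose proof (Rmin_r d (eps / A)).
  specialize (K w ltac:(lra)).
  replace (f w - f z)%C with ((f w - f z - (w - z) * l) + (w - z) * l)%C by ring.
  eapply Rle_lt_trans; [apply Cmod_triangle|]. rewrite Cmod_mult.
  assert (Cmod (w - z) < eps / A) by lra.
  apply Rmult_lt_compat_l with (r := A) in H2; [|lra]. field_simplify in H2; [|lra].
  unfold A in H2. lra.
Qed.

Lemma has_cderiv_minus f g z l m : has_cderiv f z l -> has_cderiv g z m ->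
  has_cderiv (fun w => f w - g w)%C z (l - m)%C.
Proof. intros H1 H2. apply (@is_derive_minus C_AbsRing C_NormedModule f g z l m H1 H2). Qed.

Lemma has_cderiv_const c z : has_cderiv (fun _ => c) z 0%C.
Proof. apply (@is_derive_const C_AbsRing C_NormedModule). Qed.

Lemma has_cderiv_AbsRing f z l :
  has_cderiv f z l <-> @is_derive C_AbsRing (AbsRing_NormedModule C_AbsRing) f z l.
Proof. unfold has_cderiv. rewrite !is_derive_eps. reflexivity. Qed.

Lemma has_cderiv_mult f g z l m : has_cderiv f z l -> has_cderiv g z m ->
  has_cderiv (fun w => f w * g w)%C z (l * g z + f z * m)%C.
Proof.
  rewrite !has_cderiv_AbsRing. intros H1 H2.
  apply (@is_derive_mult C_AbsRing f g z l m H1 H2 Cmult_comm).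
Qed.

Lemma Cmod_pos_neq (z : C) : 0 < Cmod z -> z <> 0%C.
Proof. now apply Cmod_gt_0. Qed.

Lemma Cminus_neq (z w : C) : z <> w -> (z - w)%C <> 0%C.
Proof. intros H K. apply H. replace z with ((z - w) + w)%C by ring. rewrite K. ring. Qed.

Lemma Cmod_minus_le (a b : C) : Cmod (a - b) <= Cmod a + Cmod b.
Proof.
  unfold Cminus. eapply Rle_trans; [apply Cmod_triangle|]. rewrite Cmod_opp. lra.
Qed.

Lemma Cmod_minus_ge (a b : C) : Cmod a - Cmod b <= Cmod (a - b).
Proof.
  pose proof (Cmod_triangle (a - b) b) as H. replace (a - b + b)%C with a in H by ring. lra.
Qed.

Lemma Cmod_minus_sym (a b : C) : Cmod (a - b) = Cmod (b - a).
Proof. rewrite <- Cmod_opp. f_equal. ring. Qed.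

(** The remainder is exactly [(w - z) ^ 2] divided by [(w - p) * (z - p) ^ 2], and [w] stays at
    distance at least [r / 2] from [p]. *)
Lemma has_cderiv_inv p z : z <> p ->
  has_cderiv (fun w => / (w - p))%C z (- / ((z - p) * (z - p)))%C.
Proof.
  intros Hn. apply Cminus_neq in Hn. rewrite has_cderiv_eps. intros eps He.
  set (r := Cmod (z - p)). assert (Hr : 0 < r) by now apply Cmod_gt_0.
  exists (Rmin (r / 2) (eps * r ^ 3 / 2)). split.
  { apply Rmin_pos; [lra|]. assert (0 < r ^ 3) by now apply pow_lt. nra. }
  intros w Hw.
  pose proof (Rmin_l (r / 2) (eps * r ^ 3 / 2)); pose proof (Rmin_r (r / 2) (eps * r ^ 3 / 2)).
  assert (Hw2 : r / 2 <= Cmod (w - p)).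
  { replace (w - p)%C with ((z - p) - (z - w))%C by ring.
    pose proof (Cmod_minus_ge (z - p) (z - w)). rewrite (Cmod_minus_sym z w) in H1. fold r in H1. lra. }
  assert (Hwn : (w - p)%C <> 0%C) by (apply Cmod_pos_neq; lra).
  replace (/ (w - p) - / (z - p) - (w - z) * - / ((z - p) * (z - p)))%C
    with ((w - z) * (w - z) / ((w - p) * ((z - p) * (z - p))))%C by (field; auto).
  rewrite Cmod_div, !Cmod_mult by (repeat apply Cmult_neq_0; auto). fold r.
  assert (0 < r ^ 3) by now apply pow_lt. pose proof (Cmod_ge_0 (w - z)).
  apply Rmult_le_reg_r with (Cmod (w - p) * (r * r)); [apply Rmult_lt_0_compat; nra|].
  unfold Rdiv. rewrite Rmult_assoc, Rinv_l, Rmult_1_r by nra.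
  apply Rle_trans with (Cmod (w - z) * (eps * r ^ 3 / 2)); [apply Rmult_le_compat_l; lra|].
  replace (Cmod (w - z) * (eps * r ^ 3 / 2)) with (eps * Cmod (w - z) * (r / 2 * (r * r))) by field.
  apply Rmult_le_compat_l; [nra|]. apply Rmult_le_compat_r; nra.
Qed.

(** * Integrals along the boundary of a rectangle *)

Definition cint (g : R -> C) (a b : R) : C :=
  (RInt (fun t => fst (g t)) a b, RInt (fun t => snd (g t)) a b).

Definition pcont (g : R -> C) (t : R) : Prop :=
  continuous (fun s => fst (g s)) t /\ continuous (fun s => snd (g s)) t.

Lemma continuous_R_eps (f : R -> R) x :
  (forall eps, 0 < eps -> exists d, 0 < d /\ forall y, Rabs (y - x) < d -> Rabs (f y - f x) < eps) ->
  continuous f x.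
Proof.
  intros H. apply filterlim_locally. intros eps.
  destruct (H eps (cond_pos eps)) as [d [Hd K]].
  exists (mkposreal _ Hd). intros y Hy. apply K. exact Hy.
Qed.

Lemma ccont_pcont (g : C -> C) (c : R -> C) t :
  ccont g (c t) -> (forall s, Cmod (c s - c t) <= Rabs (s - t)) -> pcont (fun s => g (c s)) t.
Proof.
  intros H Hc. split; apply continuous_R_eps; intros eps He;
    destruct (H eps He) as [d [Hd K]]; exists d; (split; [assumption|]); intros y Hy;
    (eapply Rle_lt_trans; [|apply (K (c y)); eapply Rle_lt_trans; [apply Hc|exact Hy]]).
  - apply (Rabs_fst_le (g (c y) - g (c t))).
  - apply (Rabs_snd_le (g (c y) - g (c t))).
Qed.

Lemma hline_lip (y s t : R) : Cmod ((s, y) - (t, y))%C <= Rabs (s - t).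
Proof.
  eapply Rle_trans; [apply Cmod_le_add|]. simpl.
  replace (y + - y) with 0 by ring. rewrite Rabs_R0. unfold Rminus. lra.
Qed.

Lemma vline_lip (x s t : R) : Cmod ((x, s) - (x, t))%C <= Rabs (s - t).
Proof.
  eapply Rle_trans; [apply Cmod_le_add|]. simpl.
  replace (x + - x) with 0 by ring. rewrite Rabs_R0. unfold Rminus. lra.
Qed.

Lemma pcont_minus g h t : pcont g t -> pcont h t -> pcont (fun s => g s - h s)%C t.
Proof. intros [H1 H2] [H3 H4]; split; simpl; apply @continuous_minus; assumption. Qed.

Lemma pcont_ex g a b : a <= b -> (forall t, a <= t <= b -> pcont g t) ->
  ex_RInt (fun t => fst (g t)) a b /\ ex_RInt (fun t => snd (g t)) a b.
Proof.
  intros Hab H; split; apply (@ex_RInt_continuous R_CompleteNormedModule);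
    intros z Hz; rewrite Rmin_left, Rmax_right in Hz by lra; apply (H z Hz).
Qed.

Lemma cint_minus g h a b : a <= b -> (forall t, a <= t <= b -> pcont g t) ->
  (forall t, a <= t <= b -> pcont h t) ->
  cint (fun t => g t - h t)%C a b = (cint g a b - cint h a b)%C.
Proof.
  intros Hab Hg Hh. apply pcont_ex in Hg; [|lra]. apply pcont_ex in Hh; [|lra].
  unfold cint. apply injective_projections; simpl;
    now apply (@RInt_minus R_CompleteNormedModule).
Qed.

Lemma cint_scal c g a b : a <= b -> (forall t, a <= t <= b -> pcont g t) ->
  cint (fun t => c * g t)%C a b = (c * cint g a b)%C.
Proof.
  intros Hab Hg. apply pcont_ex in Hg; [|lra]. destruct Hg as [H1 H2].
  unfold cint. apply injective_projections; simpl.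
  - rewrite (@RInt_minus R_CompleteNormedModule (fun t => fst c * fst (g t)) (fun t => snd c * snd (g t)))
      by (apply @ex_RInt_scal; assumption).
    rewrite !(@RInt_scal R_CompleteNormedModule) by assumption. reflexivity.
  - rewrite (@RInt_plus R_CompleteNormedModule (fun t => fst c * snd (g t)) (fun t => snd c * fst (g t)))
      by (apply @ex_RInt_scal; assumption).
    rewrite !(@RInt_scal R_CompleteNormedModule) by assumption. reflexivity.
Qed.

Lemma cint_ext g h a b : a <= b -> (forall t, a <= t <= b -> g t = h t) -> cint g a b = cint h a b.
Proof.
  intros Hab H. unfold cint. f_equal; apply RInt_ext; intros t Ht;
    rewrite Rmin_left, Rmax_right in Ht by lra; rewrite H; auto; lra.
Qed.

Lemma cint_Chasles g a b c : a <= b -> b <= c -> (forall t, a <= t <= c -> pcont g t) ->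
  cint g a c = (cint g a b + cint g b c)%C.
Proof.
  intros Hab Hbc H.
  destruct (pcont_ex g a b) as [H1 H2]; [lra|intros; apply H; lra|].
  destruct (pcont_ex g b c) as [H3 H4]; [lra|intros; apply H; lra|].
  unfold cint. apply injective_projections; simpl; symmetry;
    now apply (@RInt_Chasles R_CompleteNormedModule).
Qed.

Lemma cint_const c a b : cint (fun _ => c) a b = (RtoC (b - a) * c)%C.
Proof.
  unfold cint. rewrite !RInt_const. apply injective_projections; simpl;
   unfold scal; simpl; unfold mult; simpl; ring.
Qed.

Lemma cint_bound g a b K : a <= b -> (forall t, a <= t <= b -> pcont g t) ->
  (forall t, a <= t <= b -> Cmod (g t) <= K) -> Cmod (cint g a b) <= 2 * K * (b - a).
Proof.
  intros Hab Hg HK. apply pcont_ex in Hg; [|lra]. destruct Hg as [H1 H2].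
  eapply Rle_trans; [apply Cmod_le_add|]. unfold cint; simpl.
  assert (Rabs (RInt (fun t => fst (g t)) a b) <= (b - a) * K).
  { apply abs_RInt_le_const; auto. intros t Ht.
    eapply Rle_trans; [apply Rabs_fst_le|apply HK; lra]. }
  assert (Rabs (RInt (fun t => snd (g t)) a b) <= (b - a) * K).
  { apply abs_RInt_le_const; auto. intros t Ht.
    eapply Rle_trans; [apply Rabs_snd_le|apply HK; lra]. }
  lra.
Qed.

(** The counterclockwise contour integral of [g], with opposite sides combined: bottom minus top,
    plus [Ci] times right minus left. *)
Definition rint (g : C -> C) (x1 x2 y1 y2 : R) : C :=
  (cint (fun x => g (x, y1) - g (x, y2)) x1 x2 +
   Ci * cint (fun y => g (x2, y) - g (x1, y)) y1 y2)%C.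

Definition on_boundary (x1 x2 y1 y2 : R) (z : C) : Prop :=
  x1 <= fst z <= x2 /\ y1 <= snd z <= y2 /\
  (fst z = x1 \/ fst z = x2 \/ snd z = y1 \/ snd z = y2).

Section Rectangle.
Variables x1 x2 y1 y2 : R.
Hypothesis Hx : x1 <= x2.
Hypothesis Hy : y1 <= y2.
Let bd := on_boundary x1 x2 y1 y2.

Lemma boundary_sides :
  (forall x, x1 <= x <= x2 -> bd (x, y1) /\ bd (x, y2)) /\
  (forall y, y1 <= y <= y2 -> bd (x1, y) /\ bd (x2, y)).
Proof. unfold bd, on_boundary; simpl; repeat split; try lra; auto. Qed.

Lemma side_pcont g : (forall z, bd z -> ccont g z) ->
  (forall x, x1 <= x <= x2 -> pcont (fun s => g (s, y1)) x /\ pcont (fun s => g (s, y2)) x) /\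
  (forall y, y1 <= y <= y2 -> pcont (fun s => g (x1, s)) y /\ pcont (fun s => g (x2, s)) y).
Proof.
  intros H. destruct boundary_sides as [S1 S2]. split; intros t Ht.
  - destruct (S1 t Ht). split; apply ccont_pcont with (c := fun s => (s, _));
      auto; intros; apply hline_lip.
  - destruct (S2 t Ht). split; apply ccont_pcont with (c := fun s => (_, s));
      auto; intros; apply vline_lip.
Qed.

Lemma rint_minus g h : (forall z, bd z -> ccont g z) -> (forall z, bd z -> ccont h z) ->
  rint (fun z => g z - h z)%C x1 x2 y1 y2 = (rint g x1 x2 y1 y2 - rint h x1 x2 y1 y2)%C.
Proof.
  intros Hg Hh. apply side_pcont in Hg. apply side_pcont in Hh.
  destruct Hg as [G1 G2], Hh as [H1 H2]. unfold rint.
  rewrite (cint_ext _ (fun x => (g (x, y1) - g (x, y2)) - (h (x, y1) - h (x, y2)))%C) by (auto; intros; ring).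
  rewrite (cint_ext _ (fun y => (g (x2, y) - g (x1, y)) - (h (x2, y) - h (x1, y)))%C y1 y2) by (auto; intros; ring).
  rewrite !cint_minus with (g := fun t => (g _ - g _)%C); auto.
  - ring.
  - intros t Ht; apply pcont_minus; apply G2; auto.
  - intros t Ht; apply pcont_minus; apply H2; auto.
  - intros t Ht; apply pcont_minus; apply G1; auto.
  - intros t Ht; apply pcont_minus; apply H1; auto.
Qed.

Lemma rint_scal c g : (forall z, bd z -> ccont g z) ->
  rint (fun z => c * g z)%C x1 x2 y1 y2 = (c * rint g x1 x2 y1 y2)%C.
Proof.
  intros Hg. apply side_pcont in Hg. destruct Hg as [G1 G2]. unfold rint.
  rewrite (cint_ext _ (fun x => c * (g (x, y1) - g (x, y2)))%C) by (auto; intros; ring).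
  rewrite (cint_ext _ (fun y => c * (g (x2, y) - g (x1, y)))%C y1 y2) by (auto; intros; ring).
  rewrite !cint_scal; auto.
  - ring.
  - intros t Ht; apply pcont_minus; apply G2; auto.
  - intros t Ht; apply pcont_minus; apply G1; auto.
Qed.

Lemma rint_ext g h : (forall z, bd z -> g z = h z) -> rint g x1 x2 y1 y2 = rint h x1 x2 y1 y2.
Proof.
  intros H. destruct boundary_sides as [S1 S2]. unfold rint. f_equal; [|f_equal].
  - apply cint_ext; auto. intros t Ht. destruct (S1 t Ht). rewrite !H; auto.
  - apply cint_ext; auto. intros t Ht. destruct (S2 t Ht). rewrite !H; auto.
Qed.

Lemma rint_bound g K : (forall z, bd z -> ccont g z) -> (forall z, bd z -> Cmod (g z) <= K) ->
  Cmod (rint g x1 x2 y1 y2) <= 4 * K * ((x2 - x1) + (y2 - y1)).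
Proof.
  intros Hg HK. apply side_pcont in Hg. destruct Hg as [G1 G2]. destruct boundary_sides as [S1 S2].
  unfold rint. eapply Rle_trans; [apply Cmod_triangle|]. rewrite Cmod_mult, Cmod_Ci, Rmult_1_l.
  assert (Cmod (cint (fun x => g (x, y1) - g (x, y2)) x1 x2) <= 2 * (K + K) * (x2 - x1))%C.
  { apply cint_bound; auto.
    - intros t Ht; apply pcont_minus; apply G1; auto.
    - intros t Ht. destruct (S1 t Ht). eapply Rle_trans; [apply Cmod_minus_le|].
      apply Rplus_le_compat; auto. }
  assert (Cmod (cint (fun y => g (x2, y) - g (x1, y)) y1 y2) <= 2 * (K + K) * (y2 - y1))%C.
  { apply cint_bound; auto.
    - intros t Ht; apply pcont_minus; apply G2; auto.
    - intros t Ht. destruct (S2 t Ht). eapply Rle_trans; [apply Cmod_minus_le|].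
      apply Rplus_le_compat; auto. }
  lra.
Qed.

(** Only [b] survives in the differences of opposite sides; the two pairs contribute [Ci * b] times
    the area with opposite signs. *)
Lemma rint_affine a b q : rint (fun z => a + (z - q) * b)%C x1 x2 y1 y2 = 0%C.
Proof.
  unfold rint.
  rewrite (cint_ext _ (fun _ => ((0, y1 - y2)%R : C) * b)%C) by
    (auto; intros; apply injective_projections; simpl; ring).
  rewrite (cint_ext _ (fun _ => ((x2 - x1, 0)%R : C) * b)%C y1 y2) by
    (auto; intros; apply injective_projections; simpl; ring).
  rewrite !cint_const. apply injective_projections; simpl; ring.
Qed.
End Rectangle.

(** The common side is traversed once in each direction and cancels. *)
Lemma rint_split_x g x1 m x2 y1 y2 : x1 <= m <= x2 -> y1 <= y2 ->
  (forall z, x1 <= fst z <= x2 -> y1 <= snd z <= y2 -> ccont g z) ->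
  rint g x1 x2 y1 y2 = (rint g x1 m y1 y2 + rint g m x2 y1 y2)%C.
Proof.
  intros Hm Hy H.
  assert (V : forall x, x1 <= x <= x2 -> forall t, y1 <= t <= y2 -> pcont (fun s => g (x, s)) t).
  { intros x Hx t Ht. apply ccont_pcont with (c := fun s => (x, s)).
    apply H; auto. intros; apply vline_lip. }
  assert (Ho : forall y, y1 <= y <= y2 -> forall t, x1 <= t <= x2 -> pcont (fun s => g (s, y)) t).
  { intros y Hyy t Ht. apply ccont_pcont with (c := fun s => (s, y)).
    apply H; auto. intros; apply hline_lip. }
  unfold rint. rewrite (cint_Chasles _ x1 m x2); try lra.
  2:{ intros t Ht; apply pcont_minus; apply Ho; lra. }
  rewrite (cint_ext (fun y => g (m, y) - g (x1, y))%C
    (fun y => (g (x2, y) - g (x1, y)) - (g (x2, y) - g (m, y)))%C y1 y2) by (auto; intros; ring).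
  rewrite (cint_minus (fun y => g (x2, y) - g (x1, y))%C); auto; [ring| |];
    intros t Ht; apply pcont_minus; apply V; lra.
Qed.

Lemma rint_split_y g x1 x2 y1 m y2 : x1 <= x2 -> y1 <= m <= y2 ->
  (forall z, x1 <= fst z <= x2 -> y1 <= snd z <= y2 -> ccont g z) ->
  rint g x1 x2 y1 y2 = (rint g x1 x2 y1 m + rint g x1 x2 m y2)%C.
Proof.
  intros Hx Hm H.
  assert (V : forall x, x1 <= x <= x2 -> forall t, y1 <= t <= y2 -> pcont (fun s => g (x, s)) t).
  { intros x Hxx t Ht. apply ccont_pcont with (c := fun s => (x, s)).
    apply H; auto. intros; apply vline_lip. }
  assert (Ho : forall y, y1 <= y <= y2 -> forall t, x1 <= t <= x2 -> pcont (fun s => g (s, y)) t).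
  { intros y Hyy t Ht. apply ccont_pcont with (c := fun s => (s, y)).
    apply H; auto. intros; apply hline_lip. }
  unfold rint. rewrite (cint_Chasles _ y1 m y2); try lra.
  2:{ intros t Ht; apply pcont_minus; apply V; lra. }
  rewrite (cint_ext (fun x => g (x, m) - g (x, y2))%C
    (fun x => (g (x, y1) - g (x, y2)) - (g (x, y1) - g (x, m)))%C x1 x2) by (auto; intros; ring).
  rewrite (cint_minus (fun x => g (x, y1) - g (x, y2))%C); auto; [ring| |];
    intros t Ht; apply pcont_minus; apply Ho; lra.
Qed.

(** * Bisection of rectangles and Goursat's theorem *)

Lemma nested_intervals (a b : nat -> R) :
  (forall n, a n <= a (S n)) -> (forall n, b (S n) <= b n) -> (forall n, a n <= b n) ->
  exists X, forall n, a n <= X <= b n.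
Proof.
  intros Ha Hb Hab.
  assert (Ha' : forall n m, (n <= m)%nat -> a n <= a m).
  { intros n m H; induction H; [lra|]. specialize (Ha m). lra. }
  assert (Hb' : forall n m, (n <= m)%nat -> b m <= b n).
  { intros n m H; induction H; [lra|]. specialize (Hb m). lra. }
  assert (Hc : forall n m, a n <= b m).
  { intros n m. specialize (Ha' n (max n m) ltac:(lia)). specialize (Hb' m (max n m) ltac:(lia)).
    specialize (Hab (max n m)). lra. }
  destruct (completeness (fun x => exists n, x = a n)) as [X [H1 H2]].
  - exists (b 0%nat). intros x [n ->]. apply Hc.
  - exists (a 0%nat). now exists 0%nat.
  - exists X. intros n; split.
    + apply H1. now exists n.
    + apply H2. intros x [m ->]. apply Hc.
Qed.

Lemma half_pow_small (w d : R) : 0 <= w -> 0 < d ->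
  exists N, forall n, (N <= n)%nat -> w * (/ 2) ^ n < d.
Proof.
  intros Hw Hd.
  destruct (pow_lt_1_zero (/ 2) ltac:(rewrite Rabs_pos_eq; lra) (d / (w + 1))) as [N HN].
  { apply Rdiv_lt_0_compat; lra. }
  exists N. intros n Hn. specialize (HN n Hn).
  rewrite Rabs_pos_eq in HN by (apply pow_le; lra).
  apply Rmult_lt_compat_l with (r := w + 1) in HN; [|lra].
  field_simplify in HN; [|lra]. assert (0 < (/ 2) ^ n) by (apply pow_lt; lra). lra.
Qed.

(** If [P] failed, one of the four quarters would fail too, and so on. The nested failing rectangles
    shrink to a point, near which the second hypothesis makes [P] true. *)
Lemma bisection (P : R -> R -> R -> R -> Prop) (x y w h : R) :
  0 <= w -> 0 <= h ->
  (forall u v a b, x <= u -> u + a <= x + w -> y <= v -> v + b <= y + h -> 0 <= a -> 0 <= b ->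
    P u v (a / 2) (b / 2) -> P (u + a / 2) v (a / 2) (b / 2) ->
    P u (v + b / 2) (a / 2) (b / 2) -> P (u + a / 2) (v + b / 2) (a / 2) (b / 2) -> P u v a b) ->
  (forall X Y, x <= X <= x + w -> y <= Y <= y + h -> exists d, 0 < d /\
    forall u v a b, x <= u -> u + a <= x + w -> y <= v -> v + b <= y + h ->
      0 <= a < d -> 0 <= b < d -> u <= X <= u + a -> v <= Y <= v + b -> P u v a b) ->
  P x y w h.
Proof.
  intros Hw Hh Hsplit Hloc. apply NNPP. intros HP.
  set (A := fun n => w * (/ 2) ^ n). set (B := fun n => h * (/ 2) ^ n).
  set (ok := fun n (c : R * R) => x <= fst c /\ fst c + A n <= x + w /\
        y <= snd c /\ snd c + B n <= y + h /\ ~ P (fst c) (snd c) (A n) (B n)).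
  assert (step : forall n (c : R * R), exists c' : R * R, ok n c ->
     (fst c <= fst c' /\ fst c' + A (S n) <= fst c + A n /\
      snd c <= snd c' /\ snd c' + B (S n) <= snd c + B n) /\ ok (S n) c').
  { intros n [u v]. destruct (classic (ok n (u, v))) as [Hok|]; [|exists (u, v); tauto].
    assert (EA : A (S n) = A n / 2) by (unfold A; simpl; field).
    assert (EB : B (S n) = B n / 2) by (unfold B; simpl; field).
    assert (PA : 0 <= A n) by (apply Rmult_le_pos; [lra|apply pow_le; lra]).
    assert (PB : 0 <= B n) by (apply Rmult_le_pos; [lra|apply pow_le; lra]).
    unfold ok in *; rewrite EA, EB in *; simpl in *. destruct Hok as (O1 & O2 & O3 & O4 & O5).
    destruct (classic (P u v (A n / 2) (B n / 2))) as [Q1|Q1];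
      [|exists (u, v); intros _; simpl; repeat split; auto; lra].
    destruct (classic (P (u + A n / 2) v (A n / 2) (B n / 2))) as [Q2|Q2];
      [|exists (u + A n / 2, v); intros _; simpl; repeat split; auto; lra].
    destruct (classic (P u (v + B n / 2) (A n / 2) (B n / 2))) as [Q3|Q3];
      [|exists (u, v + B n / 2); intros _; simpl; repeat split; auto; lra].
    destruct (classic (P (u + A n / 2) (v + B n / 2) (A n / 2) (B n / 2))) as [Q4|Q4];
      [|exists (u + A n / 2, v + B n / 2); intros _; simpl; repeat split; auto; lra].
    exfalso. apply O5. apply Hsplit; auto. }
  (* Turns the existence of a failing quarter into a function, so that the nested sequence can be
     defined by recursion. *)
  assert (nxt : forall n c, {c' | ok n c ->
     (fst c <= fst c' /\ fst c' + A (S n) <= fst c + A n /\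
      snd c <= snd c' /\ snd c' + B (S n) <= snd c + B n) /\ ok (S n) c'})
    by (intros; apply constructive_indefinite_description; apply step).
  set (c := fix c n := match n with O => (x, y) | S k => proj1_sig (nxt k (c k)) end).
  assert (Hok : forall n, ok n (c n)).
  { induction n as [|n IH].
    - unfold ok, A, B; simpl. rewrite !Rmult_1_r. repeat split; auto; lra.
    - simpl. now apply (proj2_sig (nxt n (c n))). }
  assert (Hst : forall n, (fst (c n) <= fst (c (S n)) /\ fst (c (S n)) + A (S n) <= fst (c n) + A n /\
      snd (c n) <= snd (c (S n)) /\ snd (c (S n)) + B (S n) <= snd (c n) + B n)).
  { intros n. simpl. now apply (proj2_sig (nxt n (c n))). }
  assert (PA : forall n, 0 <= A n) by (intros; apply Rmult_le_pos; [lra|apply pow_le; lra]).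
  assert (PB : forall n, 0 <= B n) by (intros; apply Rmult_le_pos; [lra|apply pow_le; lra]).
  destruct (nested_intervals (fun n => fst (c n)) (fun n => fst (c n) + A n)) as [X HX];
    [intros n; apply Hst|intros n; apply Hst|intros n; specialize (PA n); lra|].
  destruct (nested_intervals (fun n => snd (c n)) (fun n => snd (c n) + B n)) as [Y HY];
    [intros n; apply Hst|intros n; apply Hst|intros n; specialize (PB n); lra|].
  destruct (Hloc X Y) as [d [Hd K]].
  { specialize (HX 0%nat). unfold A in HX. simpl in HX. lra. }
  { specialize (HY 0%nat). unfold B in HY. simpl in HY. lra. }
  destruct (half_pow_small w d Hw Hd) as [N1 HN1].
  destruct (half_pow_small h d Hh Hd) as [N2 HN2].
  set (n := max N1 N2).
  destruct (Hok n) as (O1 & O2 & O3 & O4 & O5). apply O5.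
  apply K; auto; split; auto; [apply HN1|apply HN2]; lia.
Qed.

(** The bound [eps * (a ^ 2 + b ^ 2)] is additive under division into four quarters, hence suited to
    [bisection]. On small rectangles it holds because the affine part of [g] integrates to zero. *)
Lemma goursat g x1 x2 y1 y2 : x1 <= x2 -> y1 <= y2 ->
  (forall z, x1 <= fst z <= x2 -> y1 <= snd z <= y2 -> exists l, has_cderiv g z l) ->
  rint g x1 x2 y1 y2 = 0%C.
Proof.
  intros Hx Hy Hg.
  assert (Hc : forall z, x1 <= fst z <= x2 -> y1 <= snd z <= y2 -> ccont g z).
  { intros z H1 H2. destruct (Hg z H1 H2) as [l Hl]. eapply has_cderiv_ccont; eassumption. }
  assert (key : forall eps, 0 < eps ->
     Cmod (rint g x1 (x1 + (x2 - x1)) y1 (y1 + (y2 - y1))) <= eps * ((x2 - x1) ^ 2 + (y2 - y1) ^ 2)).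
  { intros eps He.
    apply (bisection (fun u v a b => Cmod (rint g u (u + a) v (v + b)) <= eps * (a ^ 2 + b ^ 2)));
      try lra.
    - intros u v a b H1 H2 H3 H4 Ha Hb Q1 Q2 Q3 Q4.
      assert (Hc' : forall z, u <= fst z <= u + a -> v <= snd z <= v + b -> ccont g z)
        by (intros z Z1 Z2; apply Hc; lra).
      rewrite (rint_split_x g u (u + a / 2)); [|lra|lra|auto].
      rewrite (rint_split_y g u (u + a / 2) v (v + b / 2)); [|lra|lra|intros; apply Hc'; lra].
      rewrite (rint_split_y g (u + a / 2) (u + a) v (v + b / 2)); [|lra|lra|intros; apply Hc'; lra].
      replace (u + a / 2 + a / 2) with (u + a) in * by field.
      replace (v + b / 2 + b / 2) with (v + b) in * by field.
      eapply Rle_trans; [apply Cmod_triangle|].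
      eapply Rle_trans; [apply Rplus_le_compat; apply Cmod_triangle|]. lra.
    - intros X Y HX HY.
      destruct (Hg (X, Y)) as [l Hl]; [simpl; lra|simpl; lra|].
      rewrite has_cderiv_eps in Hl.
      (* The remainder is at most [eps / 8 * (a + b)] on the boundary, so [rint_bound] yields
         [eps / 2 * (a + b) ^ 2], which is at most [eps * (a ^ 2 + b ^ 2)]. *)
      destruct (Hl (eps / 8)) as [d [Hd K]]; [lra|].
      exists (d / 2); split; [lra|].
      intros u v a b H1 H2 H3 H4 Ha Hb HuX HvY.
      assert (Haff : forall z, ccont (fun z => g (X, Y) + (z - (X, Y)) * l)%C z).
      { intros z. intros e2 He2. exists (e2 / (1 + Cmod l)). pose proof (Cmod_ge_0 l).
        split; [apply Rdiv_lt_0_compat; lra|].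
        intros w Hw. replace (_ - _)%C with ((w - z) * l)%C by ring. rewrite Cmod_mult.
        apply Rmult_lt_compat_r with (r := 1 + Cmod l) in Hw; [|lra].
        field_simplify in Hw; [|lra]. pose proof (Cmod_ge_0 (w - z)). nra. }
      assert (Hdist : forall z, on_boundary u (u + a) v (v + b) z -> Cmod (z - (X, Y)) <= a + b).
      { intros z (Z1 & Z2 & _). eapply Rle_trans; [apply Cmod_le_add|]. simpl.
        apply Rplus_le_compat; apply Rabs_le; lra. }
      assert (Hcg : forall z, on_boundary u (u + a) v (v + b) z -> ccont g z).
      { intros z (Z1 & Z2 & _). apply Hc; lra. }
      assert (E : rint g u (u + a) v (v + b) =
        rint (fun z => g z - (g (X, Y) + (z - (X, Y)) * l))%C u (u + a) v (v + b)).
      { rewrite rint_minus, rint_affine; auto; try lra. ring. }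
      rewrite E.
      eapply Rle_trans.
      + apply rint_bound with (K := eps / 8 * (a + b)); try lra.
        * intros z Hz. apply ccont_minus; auto.
        * intros z Hz. specialize (Hdist z Hz). specialize (K z ltac:(lra)).
          replace (_ - _)%C with (g z - g (X, Y) - (z - (X, Y)) * l)%C by ring.
          eapply Rle_trans; [exact K|]. apply Rmult_le_compat_l; lra.
      + replace (u + a - u) with a by ring. replace (v + b - v) with b by ring. 
        pose proof (pow2_ge_0 (a - b)). nra. }
  replace (x1 + (x2 - x1)) with x2 in key by ring. replace (y1 + (y2 - y1)) with y2 in key by ring.
  apply Cmod_eq_0. set (S := (x2 - x1) ^ 2 + (y2 - y1) ^ 2) in *.
  assert (0 <= S) by (unfold S; pose proof (pow2_ge_0 (x2 - x1)); pose proof (pow2_ge_0 (y2 - y1)); lra).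
  apply Rle_antisym; [|apply Cmod_ge_0].
  apply le_epsilon. intros e He. rewrite Rplus_0_l.
  specialize (key (e / (S + 1)) ltac:(apply Rdiv_lt_0_compat; lra)).
  eapply Rle_trans; [exact key|]. apply Rmult_le_reg_r with (S + 1); [lra|].
  field_simplify; [|lra]. nra.
Qed.

(** * Cauchy's formula on squares *)

(** Four rectangles around a small square centred at [p] contribute zero by [goursat]. Continuity
    bounds [g] on that square, so its contribution tends to zero with its side. *)
Lemma goursat_puncture g (p : C) A :
  (forall z, ccont g z) -> (forall z, z <> p -> exists l, has_cderiv g z l) ->
  - A < fst p < A -> - A < snd p < A ->
  rint g (- A) A (- A) A = 0%C.
Proof.
  intros Hc Hd H1 H2.
  set (m := Rmin (Rmin (A - fst p) (A + fst p)) (Rmin (A - snd p) (A + snd p))).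
  assert (Hm : 0 < m) by (unfold m; repeat apply Rmin_pos; lra).
  assert (Hm1 : m <= A - fst p /\ m <= A + fst p /\ m <= A - snd p /\ m <= A + snd p).
  { unfold m. repeat split;
    [eapply Rle_trans; [apply Rmin_l|apply Rmin_l]|eapply Rle_trans; [apply Rmin_l|apply Rmin_r]
    |eapply Rle_trans; [apply Rmin_r|apply Rmin_l]|eapply Rle_trans; [apply Rmin_r|apply Rmin_r]]. }
  destruct (Hc p 1 Rlt_0_1) as [d0 [Hd0 K0]].
  set (K := 1 + Cmod (g p)). assert (HK : 0 < K) by (unfold K; pose proof (Cmod_ge_0 (g p)); lra).
  apply Cmod_eq_0. apply Rle_antisym; [|apply Cmod_ge_0]. apply le_epsilon. intros e He.
  rewrite Rplus_0_l.
  (* The three bounds keep the small square inside the large one, keep it where [g] is bounded by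
     [K], and make the estimate [16 * K * s] at most [e]. *)
  set (s := Rmin m (Rmin (d0 / 4) (e / (16 * K)))).
  assert (Hs : 0 < s) by (unfold s; repeat apply Rmin_pos; try lra; apply Rdiv_lt_0_compat; lra).
  assert (Hs1 : s <= m) by apply Rmin_l.
  assert (Hs2 : s <= d0 / 4) by (eapply Rle_trans; [apply Rmin_r|apply Rmin_l]).
  assert (Hs3 : s <= e / (16 * K)) by (eapply Rle_trans; [apply Rmin_r|apply Rmin_r]).
  assert (Z : forall x1 x2 y1 y2, x1 <= x2 -> y1 <= y2 ->
     (fst p < x1 \/ x2 < fst p \/ snd p < y1 \/ y2 < snd p) -> rint g x1 x2 y1 y2 = 0%C).
  { intros x1 x2 y1 y2 Hx Hy Hp. apply goursat; auto. intros z Z1 Z2. apply Hd.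
    intros ->. lra. }
  rewrite (rint_split_y g (- A) A (- A) (snd p - s) A) by (auto; lra).
  rewrite (rint_split_y g (- A) A (snd p - s) (snd p + s) A) by (auto; lra).
  rewrite (rint_split_x g (- A) (fst p - s) A (snd p - s) (snd p + s)) by (auto; lra).
  rewrite (rint_split_x g (fst p - s) (fst p + s) A (snd p - s) (snd p + s)) by (auto; lra).
  rewrite (Z (- A) A (- A) (snd p - s)), (Z (- A) A (snd p + s) A),
    (Z (- A) (fst p - s)), (Z (fst p + s) A) by lra.
  replace (0 + _)%C with (rint g (fst p - s) (fst p + s) (snd p - s) (snd p + s)) by ring.
  eapply Rle_trans; [apply rint_bound with (K := K); auto; try lra|].
  - intros z (Z1 & Z2 & _). assert (Cmod (z - p) < d0).
    { eapply Rle_lt_trans; [apply Cmod_le_add|]. simpl.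
      apply Rle_lt_trans with (s + s); [|lra]. apply Rplus_le_compat; apply Rabs_le; lra. }
    specialize (K0 z H). pose proof (Cmod_minus_ge (g z) (g p)). unfold K. lra.
  - apply Rmult_le_compat_r with (r := 16 * K) in Hs3; [|lra].
    field_simplify in Hs3; [|lra]. lra.
Qed.

Section CauchyKernel.
Variable f : C -> C.
Variable D : C -> C.
Hypothesis HD : forall z, has_cderiv f z (D z).

(** The value at [p] removes the singularity: the quotient is continuous everywhere and
    differentiable off [p], as [goursat_puncture] requires. *)
Definition dquot (p z : C) : C :=
  if excluded_middle_informative (z = p) then D p else ((f z - f p) * / (z - p))%C.

Lemma dquot_off p z : z <> p -> dquot p z = ((f z - f p) * / (z - p))%C.
Proof. intros H. unfold dquot. destruct (excluded_middle_informative (z = p)); tauto. Qed.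

Lemma dquot_deriv p z : z <> p -> exists l, has_cderiv (dquot p) z l.
Proof.
  intros H. eexists.
  pose proof (has_cderiv_mult _ _ z _ _ (has_cderiv_minus f (fun _ => f p) z _ _ (HD z) (has_cderiv_const _ z))
    (has_cderiv_inv p z H)) as K.
  rewrite has_cderiv_eps in K |- *. intros eps He. destruct (K eps He) as [d [Hd Kd]].
  assert (Hr : 0 < Cmod (z - p)) by now apply Cmod_gt_0, Cminus_neq.
  exists (Rmin d (Cmod (z - p))); split; [now apply Rmin_pos|]. intros w Hw.
  pose proof (Rmin_l d (Cmod (z - p))); pose proof (Rmin_r d (Cmod (z - p))).
  rewrite !dquot_off; auto.
  - apply Kd. lra.
  - intros ->. rewrite Cmod_minus_sym in Hw. lra.
Qed.

Lemma dquot_ccont p z : ccont (dquot p) z.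
Proof.
  destruct (excluded_middle_informative (z = p)) as [->|H].
  - intros eps He. pose proof (HD p) as K. rewrite has_cderiv_eps in K.
    destruct (K (eps / 2)) as [d [Hd Kd]]; [lra|]. exists d; split; auto. intros w Hw.
    unfold dquot at 2. destruct (excluded_middle_informative (p = p)) as [_|]; [|tauto].
    unfold dquot. destruct (excluded_middle_informative (w = p)) as [->|Hn].
    + unfold Cminus. rewrite Cplus_opp_r, Cmod_0. lra.
    + apply Cminus_neq in Hn. specialize (Kd w Hw).
      replace ((f w - f p) * / (w - p) - D p)%C with ((f w - f p - (w - p) * D p) / (w - p))%C by (field; auto).
      rewrite Cmod_div by auto. assert (0 < Cmod (w - p)) by now apply Cmod_gt_0.
      apply Rle_lt_trans with (eps / 2); [|lra].
      apply Rmult_le_reg_r with (Cmod (w - p)); [lra|]. unfold Rdiv at 1.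
      rewrite Rmult_assoc, Rinv_l by lra. lra.
  - destruct (dquot_deriv p z H) as [l Hl]. eapply has_cderiv_ccont; eassumption.
Qed.

Variable M : R.
Hypothesis HM : 0 < M.
(** Large enough that a point of modulus below [M] is at distance at least 1 from the boundary of
    the square, and at least [A / 2] from each side. *)
Let A := 2 * M + 1.
Let bd := on_boundary (- A) A (- A) A.
Let J g := rint g (- A) A (- A) A.

Lemma square_side_le : - A <= A.
Proof. unfold A; lra. Qed.

Lemma boundary_far p z : Cmod p < M -> bd z -> 1 <= Cmod (z - p) /\ z <> p.
Proof.
  intros Hp (Z1 & Z2 & Z3).
  pose proof (Rabs_fst_le p). pose proof (Rabs_snd_le p).
  assert (Hp1 : - M < fst p < M) by (apply Rabs_lt_between; lra).
  assert (Hp2 : - M < snd p < M) by (apply Rabs_lt_between; lra).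
  assert (1 <= Cmod (z - p)).
  { pose proof (Rabs_fst_le (z - p)). pose proof (Rabs_snd_le (z - p)). simpl in *.
    pose proof (Rle_abs (fst z + - fst p)); pose proof (Rle_abs (- (fst z + - fst p))).
    pose proof (Rle_abs (snd z + - snd p)); pose proof (Rle_abs (- (snd z + - snd p))).
    rewrite Rabs_Ropp in *. unfold A in *. destruct Z3 as [Z|[Z|[Z|Z]]]; lra. }
  split; auto. intros ->. unfold Cminus in H1. rewrite Cplus_opp_r, Cmod_0 in H1. lra.
Qed.

Lemma boundary_inv_bound p z : Cmod p < M -> bd z -> Cmod (/ (z - p)) <= 1.
Proof.
  intros Hp Hz. destruct (boundary_far p z Hp Hz) as [H1 H2]. apply Cminus_neq in H2.
  rewrite Cmod_inv by auto. rewrite <- Rinv_1. apply Rinv_le_contravar; lra.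
Qed.

Lemma boundary_inv_ex_cderiv p z : Cmod p < M -> bd z -> exists l, has_cderiv (fun z => / (z - p))%C z l.
Proof. intros Hp Hz. eexists. apply has_cderiv_inv. now apply (boundary_far p z). Qed.

Definition winding p := J (fun z => / (z - p))%C.

Lemma square_norm_bound u v : Rabs u <= 2 * A -> Rabs v <= 2 * A -> u * u + v * v <= 8 * A * A.
Proof.
  intros Hu Hv. apply Rabs_le_between in Hu. apply Rabs_le_between in Hv. nra.
Qed.

(* Only the non-vanishing of [winding] is needed, so its value [2 i pi] is never computed. *)
Lemma winding_Im p : Cmod p < M -> / 2 <= snd (winding p).
Proof.
  intros Hp. pose proof (Rabs_fst_le p). pose proof (Rabs_snd_le p).
  assert (Hp1 : - M < fst p < M) by (apply Rabs_lt_between; lra).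
  assert (Hp2 : - M < snd p < M) by (apply Rabs_lt_between; lra).
  assert (HA : 2 * M < A) by (unfold A; lra).
  pose proof square_side_le as HAA.
  destruct (side_pcont (- A) A (- A) A square_side_le square_side_le (fun z => / (z - p))%C) as [S1 S2].
  { intros z Hz. destruct (boundary_inv_ex_cderiv p z Hp Hz) as [l Hl]. eapply has_cderiv_ccont; eassumption. }
  (* On each pair of opposite sides the relevant coordinate of the integrand is a sum of two such
     quotients, hence at least [/ (8 * A)]. Integration over length [2 * A] gives [/ 4] per pair. *)
  assert (Low : forall u v, u * u + v * v <= 8 * A * A -> A / 2 <= v -> / (16 * A) <= v / (u ^ 2 + v ^ 2)).
  { intros u v H1 H2. assert (0 < u ^ 2 + v ^ 2) by nra.
    apply Rmult_le_reg_r with (u ^ 2 + v ^ 2); [lra|].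
    unfold Rdiv. rewrite Rmult_assoc, Rinv_l, Rmult_1_r by lra.
    apply Rmult_le_reg_l with (16 * A); [lra|]. rewrite <- Rmult_assoc, Rinv_r, Rmult_1_l by lra. nra. }
  assert (Lint : forall g, (forall t, - A <= t <= A -> pcont g t) ->
     (forall pr : C -> R, (pr = fst \/ pr = snd) ->
      (forall t, - A <= t <= A -> / (8 * A) <= pr (g t)) -> / 4 <= RInt (fun t => pr (g t)) (- A) A)).
  { intros g Hg pr Hpr Hb. apply pcont_ex in Hg; [|lra].
    replace (/ 4) with (RInt (fun _ => / (8 * A)) (- A) A).
    2:{ rewrite RInt_const. unfold scal; simpl; unfold mult; simpl. field. lra. }
    apply RInt_le; auto; [apply @ex_RInt_const| |intros; apply Hb; lra].
    destruct Hpr as [->| ->]; tauto. }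
  unfold winding, J, rint. simpl.
  rewrite Rmult_0_l, Rplus_0_l, Rmult_1_l.
  set (gh := fun x => (/ ((x, - A)%R - p) - / ((x, A)%R - p))%C).
  set (gv := fun y => (/ ((A, y)%R - p) - / ((- A, y)%R - p))%C).
  assert (H1 : / 4 <= RInt (fun t => snd (gh t)) (- A) A).
  { apply (Lint gh); auto.
    - intros t Ht. exact (pcont_minus _ _ t (proj1 (S1 t Ht)) (proj2 (S1 t Ht))).
    - intros t Ht. unfold gh. simpl.
      assert (B1 : Rabs (t + - fst p) <= 2 * A) by (apply Rabs_le; lra).
      pose proof (Low (t + - fst p) (A + snd p)).
      pose proof (Low (t + - fst p) (A + - snd p)).
      specialize (H1 ltac:(apply square_norm_bound; [auto|apply Rabs_le; lra]) ltac:(lra)).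
      specialize (H2 ltac:(apply square_norm_bound; [auto|apply Rabs_le; lra]) ltac:(lra)).
      replace (/ (8 * A)) with (/ (16 * A) + / (16 * A)) by (field; lra).
      replace (- (- A + - snd p)) with (A + snd p) by ring.
      replace ((- A + - snd p) * ((- A + - snd p) * 1)) with ((A + snd p) ^ 2) by ring.
      replace ((t + - fst p) * ((t + - fst p) * 1)) with ((t + - fst p) ^ 2) by ring.
      replace ((A + - snd p) * ((A + - snd p) * 1)) with ((A + - snd p) ^ 2) by ring.
      unfold Rdiv in *. lra. }
  assert (H2 : / 4 <= RInt (fun t => fst (gv t)) (- A) A).
  { apply (Lint gv); auto.
    - intros t Ht. exact (pcont_minus _ _ t (proj2 (S2 t Ht)) (proj1 (S2 t Ht))).
    - intros t Ht. unfold gv. simpl.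
      assert (B1 : Rabs (t + - snd p) <= 2 * A) by (apply Rabs_le; lra).
      pose proof (Low (t + - snd p) (A + fst p)).
      pose proof (Low (t + - snd p) (A + - fst p)).
      specialize (H2 ltac:(apply square_norm_bound; [auto|apply Rabs_le; lra]) ltac:(lra)).
      specialize (H3 ltac:(apply square_norm_bound; [auto|apply Rabs_le; lra]) ltac:(lra)).
      replace (/ (8 * A)) with (/ (16 * A) + / (16 * A)) by (field; lra).
      replace ((- A + - fst p) * ((- A + - fst p) * 1)) with ((A + fst p) ^ 2) by ring.
      replace (- A + - fst p) with (- (A + fst p)) by ring.
      replace ((t + - snd p) * ((t + - snd p) * 1)) with ((t + - snd p) ^ 2) by ring.
      replace ((A + - fst p) * ((A + - fst p) * 1)) with ((A + - fst p) ^ 2) by ring.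
      rewrite !(Rplus_comm (_ ^ 2) ((t + - snd p) ^ 2)).
      unfold Rdiv in *. lra. }
  change (/ 2 <= RInt (fun t => snd (gh t)) (- A) A + RInt (fun t => fst (gv t)) (- A) A). lra.
Qed.

Lemma winding_lower p : Cmod p < M -> / 2 <= Cmod (winding p).
Proof.
  intros Hp. pose proof (winding_Im p Hp). pose proof (Rabs_snd_le (winding p)).
  pose proof (Rle_abs (snd (winding p))). lra.
Qed.

Lemma rint_dquot p : Cmod p < M -> J (dquot p) = 0%C.
Proof.
  intros Hp. pose proof (Rabs_fst_le p). pose proof (Rabs_snd_le p).
  assert (Hp1 : - M < fst p < M) by (apply Rabs_lt_between; lra).
  assert (Hp2 : - M < snd p < M) by (apply Rabs_lt_between; lra).
  unfold J. apply (goursat_puncture (dquot p) p A).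
  - apply dquot_ccont.
  - apply dquot_deriv.
  - unfold A; lra.
  - unfold A; lra.
Qed.

Lemma ex_cderiv_ccont g z : (exists l, has_cderiv g z l) -> ccont g z.
Proof. intros [l Hl]. eapply has_cderiv_ccont; eassumption. Qed.

(** Cauchy's integral formula, with [winding p] in the place of [2 i pi]; it expresses that the
    integral of [dquot p] vanishes. *)
Lemma cauchy_value p : Cmod p < M -> J (fun z => f z * / (z - p))%C = (f p * winding p)%C.
Proof.
  intros Hp.
  assert (E : J (dquot p) = J (fun z => f z * / (z - p) - f p * / (z - p))%C).
  { unfold J. apply rint_ext; try exact square_side_le. intros z Hz. rewrite dquot_off; [ring|]. now apply (boundary_far p z). }
  rewrite rint_dquot in E by auto. unfold J in E. rewrite rint_minus in E; try exact square_side_le.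
  - rewrite rint_scal in E; try exact square_side_le.
    + unfold winding, J.
      replace (rint (fun z => f z * / (z - p))%C (- A) A (- A) A)
        with ((rint (fun z => f z * / (z - p))%C (- A) A (- A) A -
          f p * rint (fun z => / (z - p))%C (- A) A (- A) A) +
          f p * rint (fun z => / (z - p))%C (- A) A (- A) A)%C by ring.
      rewrite <- E. ring.
    + intros z Hz. now apply ex_cderiv_ccont, boundary_inv_ex_cderiv.
  - intros z Hz. apply ex_cderiv_ccont. destruct (boundary_inv_ex_cderiv p z Hp Hz) as [l Hl].
    eexists. apply has_cderiv_mult; eauto.
  - intros z Hz. apply ex_cderiv_ccont. destruct (boundary_inv_ex_cderiv p z Hp Hz) as [l Hl].
    eexists. apply has_cderiv_mult; eauto using has_cderiv_const.
Qed.

Definition cauchy_kernel p q z : C := ((f z - f p) * (/ (z - p) * / (z - q)))%C.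

Lemma cauchy_kernel_deriv p q z : Cmod p < M -> Cmod q < M -> bd z -> exists l, has_cderiv (cauchy_kernel p q) z l.
Proof.
  intros Hp Hq Hz. destruct (boundary_inv_ex_cderiv p z Hp Hz) as [l Hl].
  destruct (boundary_inv_ex_cderiv q z Hq Hz) as [m Hm].
  eexists. apply has_cderiv_mult.
  - apply has_cderiv_minus; [apply HD|apply has_cderiv_const].
  - apply has_cderiv_mult; eassumption.
Qed.

(** The integrals of [dquot p] and [dquot q] both vanish, and on the boundary their difference is
    [(p - q) * cauchy_kernel p q z - (f p - f q) / (z - q)]. *)
Lemma cauchy_difference p q : Cmod p < M -> Cmod q < M ->
  ((f p - f q) * winding q = (p - q) * J (cauchy_kernel p q))%C.
Proof.
  intros Hp Hq.
  assert (E : J (fun z => dquot p z - dquot q z)%C =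
    J (fun z => (p - q) * cauchy_kernel p q z - (f p - f q) * / (z - q))%C).
  { unfold J. apply rint_ext; try exact square_side_le. intros z Hz.
    destruct (boundary_far p z Hp Hz) as [_ Np]. destruct (boundary_far q z Hq Hz) as [_ Nq].
    rewrite !dquot_off by auto. unfold cauchy_kernel. apply Cminus_neq in Np. apply Cminus_neq in Nq.
    field. auto. }
  unfold J in E. rewrite !rint_minus in E; try exact square_side_le.
  - change (J (dquot p) - J (dquot q) = rint (fun z => (p - q) * cauchy_kernel p q z)%C (- A) A (- A) A -
      rint (fun z => (f p - f q) * / (z - q))%C (- A) A (- A) A)%C in E.
    rewrite !rint_dquot in E by auto.
    rewrite !rint_scal in E; try exact square_side_le.
    + unfold winding, J.
      match goal with |- ?a = ?b => replace b with ((b - a) + a)%C by ring end.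
      rewrite <- E. ring.
    + intros z Hz. now apply ex_cderiv_ccont, boundary_inv_ex_cderiv.
    + intros z Hz. now apply ex_cderiv_ccont, cauchy_kernel_deriv.
  - intros z Hz. apply ex_cderiv_ccont. destruct (cauchy_kernel_deriv p q z Hp Hq Hz) as [l Hl].
    eexists. apply has_cderiv_mult; eauto using has_cderiv_const.
  - intros z Hz. apply ex_cderiv_ccont. destruct (boundary_inv_ex_cderiv q z Hq Hz) as [l Hl].
    eexists. apply has_cderiv_mult; eauto using has_cderiv_const.
  - intros z Hz. apply dquot_ccont.
  - intros z Hz. apply dquot_ccont.
Qed.

Lemma segment_bounded (c : R -> C) a b : a <= b ->
  (forall t, forall s, Cmod (c s - c t) <= Rabs (s - t)) ->
  exists K, forall t, a <= t <= b -> Cmod (f (c t)) <= K.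
Proof.
  intros Hab Hc.
  destruct (continuity_ab_maj (fun t => Cmod (f (c t))) a b Hab) as [m [Hm _]].
  - intros t Ht. apply continuity_pt_filterlim. apply continuous_R_eps. intros e He.
    destruct (has_cderiv_ccont _ _ _ (HD (c t)) e He) as [d [Hd K]].
    exists d; split; auto. intros s Hs.
    eapply Rle_lt_trans; [|apply (K (c s)); eapply Rle_lt_trans; [apply Hc|exact Hs]].
    apply Rabs_le. pose proof (Cmod_minus_ge (f (c s)) (f (c t))).
    pose proof (Cmod_minus_ge (f (c t)) (f (c s))). rewrite Cmod_minus_sym in H0. lra.
  - eexists. exact Hm.
Qed.

Lemma boundary_bounded : exists K, 0 <= K /\ forall z, bd z -> Cmod (f z) <= K.
Proof.
  destruct (segment_bounded (fun t => (t, - A)) (- A) A square_side_le ltac:(intros; apply hline_lip)) as [K1 H1].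
  destruct (segment_bounded (fun t => (t, A)) (- A) A square_side_le ltac:(intros; apply hline_lip)) as [K2 H2].
  destruct (segment_bounded (fun t => (- A, t)) (- A) A square_side_le ltac:(intros; apply vline_lip)) as [K3 H3].
  destruct (segment_bounded (fun t => (A, t)) (- A) A square_side_le ltac:(intros; apply vline_lip)) as [K4 H4].
  exists (Rabs K1 + Rabs K2 + Rabs K3 + Rabs K4).
  pose proof (Rle_abs K1); pose proof (Rle_abs K2); pose proof (Rle_abs K3); pose proof (Rle_abs K4).
  pose proof (Rabs_pos K1); pose proof (Rabs_pos K2); pose proof (Rabs_pos K3); pose proof (Rabs_pos K4).
  split; [lra|]. intros [x y] (Z1 & Z2 & Z3). simpl in *.
  destruct Z3 as [Z|[Z|[Z|Z]]]; subst.
  - specialize (H3 y Z2). lra.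
  - specialize (H4 y Z2). lra.
  - specialize (H1 x Z1). lra.
  - specialize (H2 x Z1). lra.
Qed.

Lemma boundary_rint_bound g K : (forall z, bd z -> exists l, has_cderiv g z l) ->
  (forall z, bd z -> Cmod (g z) <= K) -> Cmod (J g) <= 16 * A * K.
Proof.
  intros H1 H2. unfold J. eapply Rle_trans.
  - apply rint_bound with (K := K); try exact square_side_le; auto.
    intros z Hz. now apply ex_cderiv_ccont, H1.
  - apply Req_le. ring.
Qed.

Lemma div_winding_le q (a : C) K : Cmod q < M -> Cmod (a * winding q) <= K -> Cmod a <= 2 * K.
Proof.
  intros Hq Ha. rewrite Cmod_mult in Ha. pose proof (winding_lower q Hq).
  pose proof (Cmod_ge_0 a). nra.
Qed.

(** [cauchy_value] bounds [f], and [cauchy_difference] bounds its difference quotients. The kernel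
    is itself Lipschitz in [p], so replacing [p] by [q] in it leaves a remainder quadratic in
    [p - q]. *)
Lemma entire_estimates_aux : exists K D', 0 < K /\
  (forall q, Cmod q < M -> Cmod (f q) <= K /\ Cmod (D' q) <= K) /\
  (forall p q, Cmod p < M -> Cmod q < M ->
     Cmod (f p - f q) <= K * Cmod (p - q) /\
     Cmod (f p - f q - (p - q) * D' q) <= K * Cmod (p - q) ^ 2).
Proof.
  destruct boundary_bounded as [F0 [HF0 HF]].
  assert (HA : 1 < A) by (unfold A; lra).
  (* Bounds [f] both on the boundary, by the first summand, and inside, by the second. *)
  set (F1 := F0 + 32 * A * F0).
  assert (HF1 : forall p, Cmod p < M -> Cmod (f p) <= F1).
  { intros p Hp. assert (Cmod (f p) <= 2 * (16 * A * F0)).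
    { apply (div_winding_le p); auto. rewrite <- cauchy_value by auto. apply boundary_rint_bound.
      - intros z Hz. destruct (boundary_inv_ex_cderiv p z Hp Hz) as [l Hl].
        eexists. apply has_cderiv_mult; eauto.
      - intros z Hz. rewrite Cmod_mult. pose proof (boundary_inv_bound p z Hp Hz). specialize (HF z Hz).
        pose proof (Cmod_ge_0 (f z)). pose proof (Cmod_ge_0 (/ (z - p))). nra. }
    unfold F1. lra. }
  assert (F01 : F0 <= F1) by (unfold F1; nra).
  assert (Kb : forall p q z, Cmod p < M -> Cmod q < M -> bd z -> Cmod (cauchy_kernel p q z) <= 2 * F1).
  { intros p q z Hp Hq Hz. unfold cauchy_kernel. rewrite !Cmod_mult.
    pose proof (boundary_inv_bound p z Hp Hz). pose proof (boundary_inv_bound q z Hq Hz).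
    pose proof (Cmod_ge_0 (/ (z - p))). pose proof (Cmod_ge_0 (/ (z - q))).
    pose proof (Cmod_ge_0 (f z - f p)).
    assert (Cmod (f z - f p) <= 2 * F1).
    { eapply Rle_trans; [apply Cmod_minus_le|]. specialize (HF z Hz). specialize (HF1 p Hp). lra. }
    assert (Cmod (/ (z - p)) * Cmod (/ (z - q)) <= 1) by nra.
    assert (0 <= Cmod (/ (z - p)) * Cmod (/ (z - q))) by nra. nra. }
  set (L := 64 * A * F1).
  assert (HL : forall p q, Cmod p < M -> Cmod q < M -> Cmod (f p - f q) <= L * Cmod (p - q)).
  { intros p q Hp Hq. replace (L * Cmod (p - q)) with (2 * (Cmod (p - q) * (16 * A * (2 * F1)))) by (unfold L; ring).
    apply (div_winding_le q); auto. rewrite cauchy_difference, Cmod_mult by auto.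
    apply Rmult_le_compat_l; [apply Cmod_ge_0|]. apply boundary_rint_bound; intros z Hz; auto.
    now apply cauchy_kernel_deriv. }
  (* The limit of the difference quotient of [f] at [q] as given by [cauchy_difference], that is,
     Cauchy's formula for the derivative. *)
  set (D' := fun q => (J (cauchy_kernel q q) * / winding q)%C).
  assert (Wn : forall q, Cmod q < M -> winding q <> 0%C).
  { intros q Hq. apply Cmod_pos_neq. pose proof (winding_lower q Hq). lra. }
  set (K := 1 + F1 + L + 32 * A * (L + 2 * F1)).
  assert (0 <= F1) by (unfold F1; nra). assert (0 <= L) by (unfold L; nra).
  assert (0 <= 32 * A * (L + 2 * F1)) by (apply Rmult_le_pos; lra).
  exists K, D'. split; [unfold K; lra|]. split.
  - intros q Hq; split; [specialize (HF1 q Hq); unfold K; lra|].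
    assert (Cmod (D' q) <= 2 * (16 * A * (2 * F1))).
    { apply (div_winding_le q); auto. unfold D'.
      replace (J (cauchy_kernel q q) * / winding q * winding q)%C with (J (cauchy_kernel q q)) by (field; auto).
      apply boundary_rint_bound; intros z Hz; auto. now apply cauchy_kernel_deriv. }
    assert (Cmod (D' q) <= L) by (unfold L; lra). unfold K. lra.
  - intros p q Hp Hq. pose proof (Cmod_ge_0 (p - q)). split.
    + eapply Rle_trans; [exact (HL p q Hp Hq)|]. apply Rmult_le_compat_r; [lra|unfold K; lra].
    + assert (Cmod (f p - f q - (p - q) * D' q) <=
        2 * (Cmod (p - q) * (16 * A * ((L + 2 * F1) * Cmod (p - q))))).
      { apply (div_winding_le q); auto.
        replace ((f p - f q - (p - q) * D' q) * winding q)%C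
          with ((f p - f q) * winding q - (p - q) * (D' q * winding q))%C by ring.
        rewrite cauchy_difference by auto. unfold D'.
        replace (J (cauchy_kernel q q) * / winding q * winding q)%C with (J (cauchy_kernel q q)) by (field; auto).
        replace ((p - q) * J (cauchy_kernel p q) - (p - q) * J (cauchy_kernel q q))%C
          with ((p - q) * (J (cauchy_kernel p q) - J (cauchy_kernel q q)))%C by ring.
        rewrite Cmod_mult. apply Rmult_le_compat_l; [apply Cmod_ge_0|].
        unfold J. rewrite <- rint_minus; try exact square_side_le.
        2:{ intros z Hz; now apply ex_cderiv_ccont, cauchy_kernel_deriv. }
        2:{ intros z Hz; now apply ex_cderiv_ccont, cauchy_kernel_deriv. }
        apply boundary_rint_bound.
        - intros z Hz. destruct (cauchy_kernel_deriv p q z Hp Hq Hz) as [l Hl].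
          destruct (cauchy_kernel_deriv q q z Hq Hq Hz) as [m Hm]. eexists. apply has_cderiv_minus; eassumption.
        - intros z Hz.
          destruct (boundary_far p z Hp Hz) as [_ Np]. destruct (boundary_far q z Hq Hz) as [_ Nq].
          apply Cminus_neq in Np. apply Cminus_neq in Nq.
          (* Exhibits a factor of size O([Cmod (p - q)]) in each summand: in the first by the
             Lipschitz bound [HL], in the second explicitly. *)
          replace (cauchy_kernel p q z - cauchy_kernel q q z)%C with
            (- ((f p - f q) * (/ (z - q) * / (z - q))) + (p - q) * (cauchy_kernel p q z * / (z - q)))%C
            by (unfold cauchy_kernel; field; auto).
          eapply Rle_trans; [apply Cmod_triangle|]. rewrite Cmod_opp, !Cmod_mult.
          pose proof (boundary_inv_bound q z Hq Hz). pose proof (Cmod_ge_0 (/ (z - q))).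
          specialize (HL p q Hp Hq). specialize (Kb p q z Hp Hq Hz).
          pose proof (Cmod_ge_0 (f p - f q)). pose proof (Cmod_ge_0 (cauchy_kernel p q z)).
          assert (Cmod (/ (z - q)) * Cmod (/ (z - q)) <= 1) by nra.
          assert (Cmod (cauchy_kernel p q z) * Cmod (/ (z - q)) <= 2 * F1) by nra.
          rewrite Rmult_plus_distr_r. apply Rplus_le_compat; [nra|].
          rewrite (Rmult_comm (2 * F1)). apply Rmult_le_compat_l; auto. }
      eapply Rle_trans; [exact H3|].
      replace (2 * _) with (32 * A * (L + 2 * F1) * Cmod (p - q) ^ 2) by ring.
      apply Rmult_le_compat_r; [nra|]. unfold K. lra.
Qed.

End CauchyKernel.

(** The quadratic remainder identifies the [D] produced by the integral formula as the derivative of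
    [f] at each point of the disc. *)
Lemma entire_estimates (f : C -> C) (M : R) : (forall z, exists l, has_cderiv f z l) -> 0 < M ->
  exists K D, 0 < K /\
  (forall q, Cmod q < M -> Cmod (f q) <= K /\ Cmod (D q) <= K /\ has_cderiv f q (D q)) /\
  (forall p q, Cmod p < M -> Cmod q < M ->
     Cmod (f p - f q) <= K * Cmod (p - q) /\
     Cmod (f p - f q - (p - q) * D q) <= K * Cmod (p - q) ^ 2).
Proof.
  intros Hf HM. destruct (choice _ Hf) as [D0 HD0].
  destruct (entire_estimates_aux f D0 HD0 M HM) as (K & D & HK & H1 & H2).
  exists K, D. split; auto. split; auto.
  intros q Hq. destruct (H1 q Hq) as [H3 H4]. split; [auto|split; [auto|]].
  apply has_cderiv_eps. intros eps He.
  exists (Rmin (M - Cmod q) (eps / K)); split; [apply Rmin_pos; [lra|now apply Rdiv_lt_0_compat]|].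
  intros w Hw. pose proof (Rmin_l (M - Cmod q) (eps / K)); pose proof (Rmin_r (M - Cmod q) (eps / K)).
  pose proof (Cmod_minus_ge w q).
  destruct (H2 w q ltac:(lra) Hq) as [_ H6]. eapply Rle_trans; [exact H6|].
  assert (Cmod (w - q) < eps / K) by lra.
  apply Rmult_lt_compat_l with (r := K) in H7; [|lra]. field_simplify in H7; [|lra].
  pose proof (Cmod_ge_0 (w - q)). nra.
Qed.

(** * Comparison of trajectories *)

(** The hitting time is the supremum of the times up to which [p] has stayed below [rho]; continuity
    excludes both [p s < rho] and [p s > rho]. *)
Lemma first_hit (p : R -> R) (T rho : R) :
  0 <= T -> p 0 < rho -> rho <= p T ->
  (forall t, 0 <= t <= T -> forall e, 0 < e -> exists d, 0 < d /\
     forall u, Rabs (u - t) < d -> Rabs (p u - p t) < e) ->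
  exists s, 0 < s <= T /\ p s = rho /\ forall u, 0 <= u < s -> p u < rho.
Proof.
  intros HT H0 H1 Hc.
  set (E := fun u => 0 <= u <= T /\ forall v, 0 <= v <= u -> p v < rho).
  assert (E0 : E 0) by (split; [lra|intros v Hv; replace v with 0 by lra; assumption]).
  destruct (completeness E) as [s [S1 S2]].
  { exists T. intros u [Hu _]. lra. }
  { now exists 0. }
  assert (Hs : 0 <= s <= T) by (split; [now apply S1|apply S2; intros u [Hu _]; lra]).
  assert (Hbefore : forall u, 0 <= u < s -> p u < rho).
  { intros u Hu. destruct (classic (exists u', E u' /\ u < u')) as [[u' [[Ha Hb] Hc']]|Hn].
    - apply Hb. lra.
    - exfalso. assert (s <= u); [|lra]. apply S2. intros v Hv.
      destruct (Rle_dec v u); auto. exfalso. apply Hn. exists v. split; auto. lra. }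
  assert (Heq : p s = rho).
  { destruct (Rtotal_order (p s) rho) as [Hlt|[He|Hgt]]; auto; exfalso.
    - destruct (Hc s Hs (rho - p s)) as [d [Hd K]]; [lra|].
      assert (s < T) by (destruct (Req_dec s T) as [->|]; lra).
      assert (HE : E (Rmin T (s + d / 2))).
      { pose proof (Rmin_l T (s + d / 2)); pose proof (Rmin_r T (s + d / 2)).
        split; [split; [apply Rmin_glb; lra|lra]|].
        intros v Hv. destruct (Rlt_dec v s); [apply Hbefore; lra|].
        assert (Rabs (v - s) < d) by (rewrite Rabs_pos_eq; lra).
        specialize (K v H4). pose proof (Rle_abs (p v - p s)). lra. }
      apply S1 in HE. assert (s < Rmin T (s + d / 2)) by (apply Rmin_glb_lt; lra). lra.
    - destruct (Hc s Hs (p s - rho)) as [d [Hd K]]; [lra|].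
      assert (0 < s) by (destruct (Req_dec s 0) as [->|]; lra).
      set (u := Rmax 0 (s - d / 2)).
      pose proof (Rmax_l 0 (s - d / 2)); pose proof (Rmax_r 0 (s - d / 2)). fold u in H2, H3.
      assert (u < s) by (apply Rmax_lub_lt; lra).
      specialize (Hbefore u ltac:(lra)).
      assert (Rabs (u - s) < d) by (rewrite Rabs_minus_sym, Rabs_pos_eq; lra).
      specialize (K u H5). pose proof (Rle_abs (- (p u - p s))). rewrite Rabs_Ropp in H6. lra. }
  exists s. repeat split; auto; try lra.
  destruct (Req_dec s 0) as [->|]; lra.
Qed.

Lemma exp_le_compat x y : x <= y -> exp x <= exp y.
Proof. intros [H| ->]; [left; now apply exp_increasing|lra]. Qed.

Lemma rder_cont z t v : rder z t v -> forall e, 0 < e -> exists d, 0 < d /\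
  forall u, Rabs (u - t) < d -> Cmod (z u - z t) < e.
Proof.
  rewrite rder_eps. intros H e He. destruct (H 1 Rlt_0_1) as [d [Hd K]].
  set (A := 1 + Cmod v). assert (HA : 0 < A) by (unfold A; pose proof (Cmod_ge_0 v); lra).
  exists (Rmin d (e / A)); split; [apply Rmin_pos; [lra|now apply Rdiv_lt_0_compat]|].
  intros u Hu. pose proof (Rmin_l d (e / A)); pose proof (Rmin_r d (e / A)).
  specialize (K u ltac:(lra)).
  replace (z u - z t)%C with ((z u - z t - RtoC (u - t) * v) + RtoC (u - t) * v)%C by ring.
  eapply Rle_lt_trans; [apply Cmod_triangle|]. rewrite Cmod_mult, Cmod_R.
  assert (Rabs (u - t) < e / A) by lra.
  apply Rmult_lt_compat_l with (r := A) in H2; [|lra]. field_simplify in H2; [|lra].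
  unfold A in H2. lra.
Qed.

(** Its level sets are squares, whose boundaries divide into straight cells without any
    trigonometry. *)
Definition supnorm (z : C) : R := Rmax (Rabs (fst z)) (Rabs (snd z)).

Lemma supnorm_lip z w : Rabs (supnorm z - supnorm w) <= Cmod (z - w).
Proof.
  assert (K : forall a b, supnorm a - supnorm b <= Cmod (a - b)).
  { intros a b. unfold supnorm.
    pose proof (Rabs_fst_le (a - b)). pose proof (Rabs_snd_le (a - b)). simpl in *.
    pose proof (Rmax_l (Rabs (fst b)) (Rabs (snd b))). pose proof (Rmax_r (Rabs (fst b)) (Rabs (snd b))).
    pose proof (Rabs_triang_inv (fst a) (fst b)). pose proof (Rabs_triang_inv (snd a) (snd b)).
    unfold Rminus in *.
    assert (Rmax (Rabs (fst a)) (Rabs (snd a)) <= Rmax (Rabs (fst b)) (Rabs (snd b)) + Cmod (a - b))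
      by (apply Rmax_lub; lra). lra. }
  apply Rabs_le. pose proof (K z w). pose proof (K w z). rewrite (Cmod_minus_sym w z) in H0. lra.
Qed.

Lemma supnorm_le_Cmod z : supnorm z <= Cmod z.
Proof. apply Rmax_Cmod. Qed.

Lemma Cmod_le_supnorm z : Cmod z <= 2 * supnorm z.
Proof.
  eapply Rle_trans; [apply Cmod_le_add|]. unfold supnorm.
  pose proof (Rmax_l (Rabs (fst z)) (Rabs (snd z))). pose proof (Rmax_r (Rabs (fst z)) (Rabs (snd z))). lra.
Qed.

(** * Estimates along the flow *)

Section Flow.
Variable f : C -> C.

Definition flows (z : R -> C) (T : R) : Prop := forall t, 0 <= t <= T -> rder z t (f (z t)).

(** At the first time at distance [s] from the start, the mean value inequality would give
    [s <= V * T]. *)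
Lemma flow_stays_in_disc z T V s : 0 <= T -> flows z T -> 0 < s ->
  (forall w, Cmod (w - z 0) <= s -> Cmod (f w) <= V) -> V * T < s -> 0 <= V ->
  forall u, 0 <= u <= T -> Cmod (z u - z 0) < s.
Proof.
  intros HT Hz Hs HV HVT HV0 u Hu. apply Rnot_le_lt. intros Hge.
  destruct (first_hit (fun v => Cmod (z v - z 0)) u s) as (x & Hx & Ex & Bx); try lra; simpl.
  - unfold Cminus. rewrite Cplus_opp_r, Cmod_0. lra.
  - intros t Ht e He. destruct (rder_cont z t _ (Hz t ltac:(lra)) e He) as [d [Hd K]].
    exists d; split; auto. intros v Hv. specialize (K v Hv).
    eapply Rle_lt_trans; [|exact K].
    pose proof (Cmod_minus_ge (z v - z 0) (z t - z 0)).
    pose proof (Cmod_minus_ge (z t - z 0) (z v - z 0)).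
    replace (z v - z 0 - (z t - z 0))%C with (z v - z t)%C in H by ring.
    replace (z t - z 0 - (z v - z 0))%C with (z t - z v)%C in H0 by ring.
    rewrite (Cmod_minus_sym (z t) (z v)) in H0. apply Rabs_le. lra.
  - pose proof (rder_mean_value z (fun t => f (z t)) 0 x V ltac:(lra)
      ltac:(intros t Ht; apply Hz; lra)) as K.
    rewrite Ex in K. assert (s <= V * (x - 0)).
    { apply K. intros t Ht. apply HV. destruct (Req_dec t x) as [->|]; [lra|].
      left. apply Bx. lra. }
    assert (V * x <= V * T) by (apply Rmult_le_compat_l; lra). lra.
Qed.

Variables (M K : R) (D : C -> C).
Hypothesis HK : 0 < K.
Hypothesis Hf1 : forall q, Cmod q < M ->
  Cmod (f q) <= K /\ Cmod (D q) <= K /\ has_cderiv f q (D q).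
Hypothesis Hf2 : forall p q, Cmod p < M -> Cmod q < M ->
     Cmod (f p - f q) <= K * Cmod (p - q) /\
     Cmod (f p - f q - (p - q) * D q) <= K * Cmod (p - q) ^ 2.

Lemma rder_f_flow z t : Cmod (z t) < M -> rder z t (f (z t)) ->
  rder (fun u => f (z u)) t (D (z t) * f (z t))%C.
Proof. intros HM Hz. apply rder_chain; [now apply Hf1|assumption]. Qed.

(** The velocity satisfies the linear equation whose coefficient is [D] along the trajectory, and
    [D] is bounded by [K]. *)
Lemma speed_gronwall z a b : a <= b ->
  (forall t, a <= t <= b -> rder z t (f (z t)) /\ Cmod (z t) < M) ->
  Cmod (f (z a)) <= exp (K * (b - a)) * Cmod (f (z b)) /\
  Cmod (f (z b)) <= exp (K * (b - a)) * Cmod (f (z a)).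
Proof.
  intros Hab Hz.
  apply (gronwall (fun u => f (z u)) (fun u => D (z u) * f (z u))%C a b K Hab).
  - intros t Ht. destruct (Hz t Ht). now apply rder_f_flow.
  - intros t Ht. rewrite Cmod_mult. apply Rmult_le_compat_r; [apply Cmod_ge_0|].
    apply Hf1. now apply Hz.
Qed.

(* The quotient [(z1 - z2) / f z2] is almost constant along the flow: numerator and denominator
   satisfy the same linear equation up to an error quadratic in [z1 - z2]. *)
Lemma nearby_flows z1 z2 sg t2 N k :
  0 <= sg -> 0 <= t2 -> 0 < N -> sg + t2 <= N ->
  flows z1 (sg + t2) -> flows z2 t2 ->
  (forall t, 0 <= t <= sg + t2 -> Cmod (z1 t) < M) ->
  (forall t, 0 <= t <= t2 -> Cmod (z2 t) < M) ->
  f (z2 0) <> 0%C ->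
  K * (exp (K * N) * Cmod (z1 (t2 + sg) - z2 t2)) * N <= 1 ->
  0 < k -> k <= Cmod (f (z2 t2)) ->
  Cmod (z1 sg - z2 0) <= exp (K * N) * Cmod (z1 (t2 + sg) - z2 t2) /\
  Cmod (z1 sg - z2 0) <= 3 * Cmod (f (z2 0)) * Cmod (z1 (t2 + sg) - z2 t2) / k.
Proof.
  intros Hsg Ht2 HN HsN Hz1 Hz2 HM1 HM2 Hf0 Hsmall Hk Hk2.
  set (d := fun u => (z1 (u + sg)%R - z2 u)%C).
  set (d' := fun u => (f (z1 (u + sg)%R) - f (z2 u))%C).
  assert (Hd : forall u, 0 <= u <= t2 -> rder d u (d' u)).
  { intros u Hu. apply rder_minus; [|apply Hz2; lra].
    apply rder_shift. apply Hz1. lra. }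
  assert (Hd' : forall u, 0 <= u <= t2 -> Cmod (d' u) <= K * Cmod (d u)).
  { intros u Hu. apply Hf2; [apply HM1; lra|apply HM2; lra]. }
  set (e := exp (K * N) * Cmod (z1 (t2 + sg)%R - z2 t2)) in *.
  assert (Hde : forall u, 0 <= u <= t2 -> Cmod (d u) <= e).
  { intros u Hu. destruct (gronwall d d' u t2 K) as [G _]; try lra;
      [intros; apply Hd; lra|intros; apply Hd'; lra|].
    eapply Rle_trans; [exact G|]. apply Rmult_le_compat_r; [apply Cmod_ge_0|].
    apply exp_le_compat. apply Rmult_le_compat_l; lra. }
  set (g := fun u => f (z2 u)).
  (* The speed cannot vanish later if it does not vanish at time 0, by [speed_gronwall]. *)
  assert (Hg : forall u, 0 <= u <= t2 -> g u <> 0%C).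
  { intros u Hu. apply Cmod_gt_0. apply Cmod_gt_0 in Hf0.
    destruct (speed_gronwall z2 0 u) as [G _]; [lra|intros t Ht; split; [apply Hz2|apply HM2]; lra|].
    pose proof (exp_pos (K * (u - 0))). unfold g. pose proof (Cmod_ge_0 (f (z2 u))).
    destruct (Req_dec (Cmod (f (z2 u))) 0) as [E|]; [rewrite E, Rmult_0_r in G; lra|lra]. }
  (* The subtraction of 0 gives the denominator the shape of [has_cderiv_inv] at the point 0. *)
  set (q := fun u => (d u * / (g u - 0))%C).
  set (q' := fun u => ((d' u - d u * D (z2 u)) * / g u)%C).
  assert (Hq : forall u, 0 <= u <= t2 -> rder q u (q' u)).
  { intros u Hu.
    pose proof (rder_chain (fun w => / (w - 0))%C g u _ _ (has_cderiv_inv 0%C (g u) (Hg u Hu))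
      (rder_f_flow z2 u (HM2 u Hu) (Hz2 u Hu))) as Hinv.
    pose proof (rder_mult d _ u _ _ (Hd u Hu) Hinv) as Hm. specialize (Hg u Hu).
    unfold q. match type of Hm with rder _ _ ?v => replace (q' u) with v; [exact Hm|] end.
    unfold q'. change (f (z2 u)) with (g u).
    assert ((g u - 0)%C <> 0%C) by (replace (g u - 0)%C with (g u) by ring; auto).
    field. auto. }
  assert (Eq : forall u, 0 <= u <= t2 -> Cmod (q u) = Cmod (d u) / Cmod (g u)).
  { intros u Hu. unfold q. replace (g u - 0)%C with (g u) by ring.
    rewrite Cmod_mult, Cmod_inv by now apply Hg. reflexivity. }
  (* The quadratic error is at most [K * e] times [Cmod (d u)], and [K * e * N <= 1] turns this into
     the relative growth rate [/ N], harmless over a time of at most [N]. *)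
  assert (Hq' : forall u, 0 <= u <= t2 -> Cmod (q' u) <= / N * Cmod (q u)).
  { intros u Hu. rewrite Eq by auto. unfold q'.
    rewrite Cmod_mult, Cmod_inv by now apply Hg.
    assert (Hp : 0 < Cmod (g u)) by now apply Cmod_gt_0, Hg.
    unfold Rdiv. rewrite <- Rmult_assoc. apply Rmult_le_compat_r; [left; now apply Rinv_0_lt_compat|].
    eapply Rle_trans; [apply Hf2; [apply HM1; lra|apply HM2; lra]|].
    change (z1 (u + sg)%R - z2 u)%C with (d u). specialize (Hde u Hu).
    pose proof (Cmod_ge_0 (d u)).
    assert (K * Cmod (d u) <= / N).
    { apply Rmult_le_reg_r with N; auto. rewrite Rinv_l by lra.
      eapply Rle_trans; [|exact Hsmall]. apply Rmult_le_compat_r; [lra|].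
      apply Rmult_le_compat_l; lra. }
    nra. }
  assert (Ed : (z1 sg - z2 0 = d 0)%C) by (unfold d; now rewrite Rplus_0_l).
  assert (Ed2 : (z1 (t2 + sg)%R - z2 t2 = d t2)%C) by reflexivity.
  split; [rewrite Ed; apply Hde; lra|].
  destruct (gronwall q q' 0 t2 (/ N)) as [G _]; auto.
  rewrite !Eq in G by lra.
  assert (Hp0 : 0 < Cmod (g 0)) by (apply Cmod_gt_0, Hg; lra).
  assert (He : exp (/ N * (t2 - 0)) <= 3).
  { eapply Rle_trans; [|apply exp_le_3]. apply exp_le_compat.
    apply Rmult_le_reg_l with N; auto. rewrite <- Rmult_assoc, Rinv_r by lra. lra. }
  rewrite Ed, Ed2.
  apply Rmult_le_compat_r with (r := Cmod (g 0)) in G; [|lra].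
  unfold Rdiv at 1 in G. rewrite Rmult_assoc, Rinv_l, Rmult_1_r in G by lra.
  eapply Rle_trans; [exact G|]. change (f (z2 0)) with (g 0).
  assert (Cmod (d t2) / Cmod (g t2) <= Cmod (d t2) / k).
  { apply Rmult_le_compat_l; [apply Cmod_ge_0|]. apply Rinv_le_contravar; auto. }
  assert (0 <= Cmod (d t2) / Cmod (g t2)).
  { apply Rmult_le_pos; [apply Cmod_ge_0|]. left. apply Rinv_0_lt_compat. unfold g. lra. }
  replace (3 * Cmod (g 0) * Cmod (d t2) / k) with (3 * (Cmod (d t2) / k) * Cmod (g 0)) by (unfold Rdiv; ring).
  apply Rmult_le_compat_r; [lra|]. pose proof (exp_pos (/ N * (t2 - 0))).
  apply Rmult_le_compat; lra.
Qed.

(** For [K * T <= / 2] the speed grows by a factor of at most [exp (/ 2) <= 2], so covering the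
    distance [w] within time [T] requires an initial speed of [w / (2 * T)]. *)
Lemma fast_step z a b w T : a < b -> b - a <= T -> K * T <= / 2 ->
  (forall t, a <= t <= b -> rder z t (f (z t)) /\ Cmod (z t) < M) ->
  w <= Cmod (z b - z a) -> w / (2 * T) <= Cmod (f (z a)).
Proof.
  intros Hab HT HKT Hz Hw.
  assert (He : exp (/ 2) <= 2).
  { apply Rsqr_incr_0_var; [|lra]. unfold Rsqr. rewrite <- exp_plus.
    replace (/ 2 + / 2) with 1 by field. pose proof exp_le_3. lra. }
  pose proof (Cmod_ge_0 (f (z a))).
  assert (Hs : forall t, a <= t <= b -> Cmod (f (z t)) <= 2 * Cmod (f (z a))).
  { intros t Ht. destruct (speed_gronwall z a t) as [_ G]; [lra|intros; apply Hz; lra|].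
    eapply Rle_trans; [exact G|]. apply Rmult_le_compat_r; [lra|].
    eapply Rle_trans; [|exact He]. apply exp_le_compat. eapply Rle_trans; [|exact HKT].
    apply Rmult_le_compat_l; lra. }
  pose proof (rder_mean_value z (fun t => f (z t)) a b (2 * Cmod (f (z a))) ltac:(lra)
      ltac:(intros t Ht; apply Hz; lra) Hs) as Hm.
  apply Rmult_le_reg_r with (2 * T); [lra|]. unfold Rdiv. rewrite Rmult_assoc, Rinv_l by lra.
  assert (2 * Cmod (f (z a)) * (b - a) <= 2 * Cmod (f (z a)) * T) by (apply Rmult_le_compat_l; lra).
  lra.
Qed.
End Flow.

(** * Trajectories in the coordinate [F] *)

Section Transversal.
Variables (f F : C -> C) (G : R -> C) (z0 : C) (r b s m V : R).
Hypothesis HF : forall z, Cmod (z - z0) < r -> has_cderiv F z (/ f z)%C.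
Hypothesis Hs : 0 < s.
Hypothesis Hm : 0 < m.
Hypothesis HB : forall y w, Rabs y <= b -> Cmod (w - G y) <= s ->
  Cmod (w - z0) < r /\ m <= Cmod (f w) <= V.
Hypothesis HFG : forall y, Rabs y <= b -> F (G y) = (0, y).

Lemma lower_le_upper_speed : forall y, Rabs y <= b -> m <= V.
Proof.
  intros y Hy. destruct (HB y (G y) Hy) as [_ H]; [|lra].
  unfold Cminus; rewrite Cplus_opp_r, Cmod_0; lra.
Qed.

(** Along a trajectory [F] has derivative [f / f = 1]. The condition [V * sg < s] keeps the
    trajectory in the disc about [G y] where this is meaningful. *)
Lemma flow_time_coordinate z y sg : Rabs y <= b -> z 0 = G y -> 0 <= sg -> V * sg < s ->
  flows f z sg -> F (z sg) = (sg, y).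
Proof.
  intros Hy Hz0 Hsg HVs Hz. pose proof (lower_le_upper_speed y Hy).
  pose proof (flow_stays_in_disc f z sg V s Hsg Hz Hs) as Hst.
  assert (Hin : forall u, 0 <= u <= sg -> Cmod (z u - G y) < s).
  { rewrite <- Hz0. apply Hst; auto; [|lra]. intros w Hw. rewrite Hz0 in Hw. now apply (HB y). }
  pose proof (rder_mean_value (fun u => F (z u) - RtoC u)%C (fun _ => 0%C) 0 sg 0 Hsg) as Hmv.
  assert (E : Cmod ((F (z sg) - RtoC sg) - (F (z 0) - RtoC 0)) <= 0 * (sg - 0)).
  { apply Hmv.
    - intros t Ht. destruct (HB y (z t) Hy) as [H1 H2]; [left; apply Hin; lra|].
      assert (Hn : f (z t) <> 0%C) by (apply Cmod_gt_0; lra).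
      replace (RtoC 0) with (/ f (z t) * f (z t) - 1)%C by (field; auto).
      apply rder_minus; [|apply rder_RtoC]. apply rder_chain; [now apply HF|now apply Hz].
    - intros t Ht. rewrite Cmod_0. lra. }
  rewrite Rmult_0_l in E. pose proof (Cmod_ge_0 ((F (z sg) - RtoC sg) - (F (z 0) - RtoC 0))).
  assert (E2 := Cmod_eq_0 _ (Rle_antisym _ _ E H0)).
  rewrite Hz0, HFG in E2 by auto.
  replace (F (z sg)) with ((F (z sg) - RtoC sg - ((0, y)%R - RtoC 0)) + (RtoC sg + (0, y)%R))%C by ring.
  rewrite E2. apply injective_projections; simpl; ring.
Qed.

(** The derivative [/ f] of [F] is at most [/ m] in modulus on the segment from [G y] to [a]. *)
Lemma transversal_coordinate_lip y a : Rabs y <= b -> Cmod (a - G y) <= s ->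
  Cmod (F a - (0, y)%R) <= / m * Cmod (a - G y).
Proof.
  intros Hy Ha. rewrite <- HFG by auto.
  set (c := fun u => (G y + RtoC u * (a - G y))%C).
  assert (Hc : forall u, 0 <= u <= 1 -> rder c u (a - G y)%C).
  { intros u Hu. match goal with |- rder _ _ ?v => replace v with (0 + (1 * (a - G y) + RtoC u * 0))%C by ring end.
    apply rder_plus; [apply rder_const|]. apply rder_mult; [apply rder_RtoC|apply rder_const]. }
  assert (Hin : forall u, 0 <= u <= 1 -> Cmod (c u - G y) <= s).
  { intros u Hu. unfold c. replace (_ - _)%C with (RtoC u * (a - G y))%C by ring.
    rewrite Cmod_mult, Cmod_R, Rabs_pos_eq by lra. pose proof (Cmod_ge_0 (a - G y)). nra. }
  pose proof (rder_mean_value (fun u => F (c u)) (fun u => / f (c u) * (a - G y))%C 0 1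
    (/ m * Cmod (a - G y)) ltac:(lra)) as Hmv.
  cbv beta in Hmv.
  replace (c 1) with a in Hmv by (unfold c; ring).
  replace (c 0) with (G y) in Hmv by (unfold c; ring).
  rewrite Rminus_0_r, Rmult_1_r in Hmv. apply Hmv.
  - intros t Ht. destruct (HB y (c t) Hy (Hin t Ht)). apply rder_chain; auto.
  - intros t Ht. destruct (HB y (c t) Hy (Hin t Ht)) as [_ H2].
    rewrite Cmod_mult, Cmod_inv by (apply Cmod_gt_0; lra).
    apply Rmult_le_compat_r; [apply Cmod_ge_0|]. apply Rinv_le_contravar; lra.
Qed.

Variables (M K : R) (D : C -> C).
Hypothesis HK : 0 < K.
Hypothesis Hf1 : forall q, Cmod q < M ->
  Cmod (f q) <= K /\ Cmod (D q) <= K /\ has_cderiv f q (D q).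
Hypothesis Hf2 : forall p q, Cmod p < M -> Cmod q < M ->
     Cmod (f p - f q) <= K * Cmod (p - q) /\
     Cmod (f p - f q - (p - q) * D q) <= K * Cmod (p - q) ^ 2.
Variable N : R.
Hypothesis HN : 0 < N.

Definition reaches (y : R) (t : R) (p : C) : Prop :=
  exists z, 0 <= t <= N /\ z 0 = G y /\ flows f z t /\
    (forall u, 0 <= u <= t -> Cmod (z u) < M) /\ z t = p.

(* Flowing both points back for the time [t2] reduces to comparing a point at time [t1 - t2],
   where [F] still reads off the time, with a point of the transversal itself. *)
Lemma separation_ordered y1 y2 t1 t2 p1 p2 k : Rabs y1 <= b -> Rabs y2 <= b ->
  reaches y1 t1 p1 -> reaches y2 t2 p2 -> t2 <= t1 -> V * (t1 - t2) < s ->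
  exp (K * N) * Cmod (p1 - p2) <= s -> K * (exp (K * N) * Cmod (p1 - p2)) * N <= 1 ->
  0 < k -> k <= Cmod (f p2) ->
  Rabs (y1 - y2) <= 3 * V / m * (Cmod (p1 - p2) / k).
Proof.
  intros Hy1 Hy2 (z1 & Ht1 & Hz10 & Hz1 & HM1 & <-) (z2 & Ht2 & Hz20 & Hz2 & HM2 & <-) Ht HVt Hs1 Hs2 Hk Hk2.
  set (sg := t1 - t2) in *. replace t1 with (t2 + sg) in * by (unfold sg; ring).
  assert (Hsg : 0 <= sg) by lra.
  destruct (HB y2 (z2 0) Hy2) as [_ Hz2m].
  { rewrite Hz20. unfold Cminus; rewrite Cplus_opp_r, Cmod_0; lra. }
  destruct (nearby_flows f M K D HK Hf1 Hf2 z1 z2 sg t2 N k) as [N1 N2]; try rewrite (Rplus_comm sg); auto; try lra.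
  { apply Cmod_gt_0. lra. }
  assert (E1 : F (z1 sg) = (sg, y1)).
  { apply flow_time_coordinate; auto. intros u Hu. apply Hz1. lra. }
  assert (L : Cmod (F (z1 sg) - (0, y2)%R) <= / m * Cmod (z1 sg - G y2)).
  { apply transversal_coordinate_lip; auto. rewrite <- Hz20. lra. }
  (* The first coordinate is the time lag [sg]; the second one isolates [y1 - y2]. *)
  rewrite E1 in L. pose proof (Rabs_snd_le ((sg, y1)%R - (0, y2)%R)) as L2. simpl in L2.
  unfold Rminus at 1. eapply Rle_trans; [exact L2|]. eapply Rle_trans; [exact L|].
  rewrite <- Hz20.
  replace (3 * V / m * (Cmod (z1 (t2 + sg)%R - z2 t2) / k))
    with (/ m * (3 * V * Cmod (z1 (t2 + sg)%R - z2 t2) / k)) by (field; lra).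
  apply Rmult_le_compat_l; [left; now apply Rinv_0_lt_compat|].
  eapply Rle_trans; [exact N2|]. unfold Rdiv. apply Rmult_le_compat_r; [left; now apply Rinv_0_lt_compat|].
  apply Rmult_le_compat_r; [apply Cmod_ge_0|]. lra.
Qed.

(** Symmetric form of [separation_ordered]: with the speed bounded below at both points, either of
    them may be the later one. *)
Lemma separation y1 y2 t1 t2 p1 p2 k w : Rabs y1 <= b -> Rabs y2 <= b ->
  reaches y1 t1 p1 -> reaches y2 t2 p2 -> V * Rabs (t1 - t2) < s ->
  Cmod (p1 - p2) <= w ->
  exp (K * N) * w <= s -> K * (exp (K * N) * w) * N <= 1 ->
  0 < k -> k <= Cmod (f p1) -> k <= Cmod (f p2) ->
  Rabs (y1 - y2) <= 3 * V / m * (w / k).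
Proof.
  intros Hy1 Hy2 H1 H2 HVt Hw Hs1 Hs2 Hk Hk1 Hk2. pose proof (lower_le_upper_speed y1 Hy1).
  pose proof (exp_pos (K * N)).
  assert (exp (K * N) * Cmod (p1 - p2) <= exp (K * N) * w) by (apply Rmult_le_compat_l; lra).
  assert (K * (exp (K * N) * Cmod (p1 - p2)) * N <= K * (exp (K * N) * w) * N).
  { apply Rmult_le_compat_r; [lra|]. apply Rmult_le_compat_l; lra. }
  apply Rle_trans with (3 * V / m * (Cmod (p1 - p2) / k)).
  - destruct (Rle_dec t2 t1) as [Hle|Hle].
    + apply (separation_ordered y1 y2 t1 t2); auto; try lra. rewrite Rabs_pos_eq in HVt by lra. lra.
    + rewrite Rabs_minus_sym, Cmod_minus_sym.
      apply (separation_ordered y2 y1 t2 t1); auto; try lra; try (rewrite Cmod_minus_sym; lra).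
      rewrite Rabs_minus_sym, Rabs_pos_eq in HVt by lra. lra.
  - apply Rmult_le_compat_l.
    + apply Rmult_le_pos; [lra|left; now apply Rinv_0_lt_compat].
    + apply Rmult_le_compat_r; [left; now apply Rinv_0_lt_compat|lra].
Qed.

End Transversal.

(** * Crossings of layers *)

(** The sum of the indicators of the intervals of half-length [h] centred at the entries of [l],
    counted with multiplicity; real-valued so that it can be integrated. *)
Definition cover_count (h y : R) (l : list R) : R :=
  fold_right (fun x acc => (if Rle_dec (Rabs (y - x)) h then 1 else 0) + acc) 0 l.

Lemma cover_count_app h y l1 l2 :
  cover_count h y (l1 ++ l2) = cover_count h y l1 + cover_count h y l2.
Proof. induction l1 as [|x l1 IH]; simpl; [lra|]. rewrite IH. lra. Qed.

Lemma cover_count_ge0 h y l : 0 <= cover_count h y l.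
Proof. induction l as [|x l IH]; simpl; [lra|]. destruct Rle_dec; lra. Qed.

Lemma cover_count_ge1 h y l x : In x l -> Rabs (y - x) <= h -> 1 <= cover_count h y l.
Proof.
  induction l as [|x' l IH]; simpl; [tauto|]. intros [->|Hin] Hy.
  - pose proof (cover_count_ge0 h y l). destruct Rle_dec; [lra|tauto].
  - specialize (IH Hin Hy). destruct Rle_dec; lra.
Qed.

(** The bound [n + 1] rather than [n] provides a bin also for [n = 0], where [v = 0]. *)
Lemma bin_exists (n : nat) (w v : R) : 0 <= v -> v <= INR n * w -> 0 < w ->
  exists k, (k < n + 1)%nat /\ INR k * w <= v <= (INR k + 1) * w.
Proof.
  intros Hv. induction n as [|n IH]; intros Hn w_pos.
  - exists 0%nat. simpl in *. split; [lia|lra].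
  - destruct (Rle_dec v (INR n * w)) as [H|H].
    + destruct (IH H w_pos) as [k [K1 K2]]. exists k; split; [lia|auto].
    + exists n. rewrite S_INR in Hn. split; [lia|lra].
Qed.

Definition inbin (rho w : R) (bn : nat) (v : R) : Prop :=
  INR bn * w <= v + rho <= (INR bn + 1) * w.

(** The values 0, 1, 2 of [sd] stand for the right, left and upper side of the square, all others
    for the lower side. *)
Definition onside (rho w : R) (sd bn : nat) (p : C) : Prop :=
  match sd with
  | 0%nat => fst p = rho /\ inbin rho w bn (snd p)
  | 1%nat => fst p = - rho /\ inbin rho w bn (snd p)
  | 2%nat => snd p = rho /\ inbin rho w bn (fst p)
  | _ => snd p = - rho /\ inbin rho w bn (fst p)
  end.

Lemma onside_close rho w sd bn p p' :
  onside rho w sd bn p -> onside rho w sd bn p' -> Cmod (p - p') <= w.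
Proof.
  intros H H'. eapply Rle_trans; [apply Cmod_le_add|]. simpl.
  assert (E : forall a c, a = c -> Rabs (a + - c) = 0) by (intros a c ->; rewrite Rplus_opp_r; apply Rabs_R0).
  assert (E2 : forall a c, inbin rho w bn a -> inbin rho w bn c -> Rabs (a + - c) <= w).
  { unfold inbin. intros a c Ha Hc. apply Rabs_le. lra. }
  destruct sd as [|[|[|sd]]]; destruct H as [H1 H2], H' as [H1' H2'];
    rewrite <- H1' in H1; pose proof (E _ _ H1); pose proof (E2 _ _ H2 H2'); lra.
Qed.

Lemma onside_exists rho (J : nat) p : 0 < rho -> (0 < J)%nat -> supnorm p = rho ->
  exists sd bn, (sd < 4)%nat /\ (bn < 2 * J + 1)%nat /\ onside rho (rho / INR J) sd bn p.
Proof.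
  intros Hr HJ Hp. pose proof (lt_0_INR J HJ) as HJ'.
  assert (w_pos : 0 < rho / INR J) by now apply Rdiv_lt_0_compat.
  assert (Bn : forall v, Rabs v <= rho -> exists bn, (bn < 2 * J + 1)%nat /\ inbin rho (rho / INR J) bn v).
  { intros v Hv. apply Rabs_le_between in Hv. apply bin_exists; auto; [lra|].
    rewrite mult_INR. simpl. field_simplify; lra. }
  unfold supnorm in Hp.
  pose proof (Rmax_l (Rabs (fst p)) (Rabs (snd p))) as M1.
  pose proof (Rmax_r (Rabs (fst p)) (Rabs (snd p))) as M2.
  destruct (Rle_dec (Rabs (snd p)) (Rabs (fst p))) as [H|H].
  - rewrite Rmax_left in Hp by lra. destruct (Bn (snd p) ltac:(lra)) as [bn [B1 B2]].
    destruct (Rle_dec 0 (fst p)).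
    + exists 0%nat, bn. rewrite Rabs_pos_eq in Hp by auto. repeat split; auto; try lia; apply B2.
    + exists 1%nat, bn. rewrite Rabs_left in Hp by lra. repeat split; auto; try lia; try apply B2. lra.
  - rewrite Rmax_right in Hp by lra. destruct (Bn (fst p) ltac:(lra)) as [bn [B1 B2]].
    destruct (Rle_dec 0 (snd p)).
    + exists 2%nat, bn. rewrite Rabs_pos_eq in Hp by auto. repeat split; auto; try lia; apply B2.
    + exists 3%nat, bn. rewrite Rabs_left in Hp by lra. repeat split; auto; try lia; try apply B2. lra.
Qed.

(** * Counting the fast crossings *)

Section Cover.
Variables (f F : C -> C) (G : R -> C) (z0 : C) (r b s m V rho0 : R).
Hypothesis Hent : forall z, exists l, has_cderiv f z l.
Hypothesis HF : forall z, Cmod (z - z0) < r -> has_cderiv F z (/ f z)%C.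
Hypothesis Hs : 0 < s.
Hypothesis Hm : 0 < m.
Hypothesis HV : 0 < V.
Hypothesis HB : forall y w, Rabs y <= b -> Cmod (w - G y) <= s ->
  Cmod (w - z0) < r /\ m <= Cmod (f w) <= V.
Hypothesis HFG : forall y, Rabs y <= b -> F (G y) = (0, y).
Hypothesis Hrho0 : 0 < rho0.
Hypothesis HG : forall y, Rabs y <= b -> Cmod (G y) < rho0.
Variable N : R.
Hypothesis HN : 0 < N.

(** Unboundedness already forces a crossing of every square; the common bound [N] on the blow-up
    times makes the average crossing short. *)
Definition blows_up_by (y : R) : Prop :=
  exists beta z, 0 < beta <= N /\ z 0 = G y /\
    (forall t, 0 <= t < beta -> rder z t (f (z t))) /\
    (forall A, exists t, 0 <= t < beta /\ A < Cmod (z t)).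

Section Scale.
Variables (M K : R) (D : C -> C) (Q J Kt : nat).
Hypothesis HK : 0 < K.
Hypothesis Hf1 : forall q, Cmod q < M ->
  Cmod (f q) <= K /\ Cmod (D q) <= K /\ has_cderiv f q (D q).
Hypothesis Hf2 : forall p q, Cmod p < M -> Cmod q < M ->
     Cmod (f p - f q) <= K * Cmod (p - q) /\
     Cmod (f p - f q - (p - q) * D q) <= K * Cmod (p - q) ^ 2.
Hypothesis HQ : (0 < Q)%nat.
Hypothesis HJ : (0 < J)%nat.
Let top := rho0 * exp (INR Q).
Hypothesis HM : 2 * top < M.
Hypothesis HJ1 : exp (K * N) * (top / INR J) <= s.
Hypothesis HJ2 : K * (exp (K * N) * (top / INR J)) * N <= 1.
Let P := (Q * J)%nat.
Let dB := 2 * N / INR P.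
Hypothesis HJ3 : K * dB <= / 2.
Let tau := s / (2 * V).
Hypothesis HKt : N <= INR Kt * tau.

(* The layers [rho i <= supnorm z <= rho (S i)], i < P, are crossed in total time at most [N],
   so at least [P / 2] of the crossings last at most [dB]; those start with speed at least
   [k i], and [h] bounds the spread of initial parameters in a cell of side [w i]. *)
Let rho (i : nat) := rho0 * exp (INR i / INR J).
Let w (i : nat) := rho i / INR J.
Let h := 3 * V / m * (2 * dB).
Let k (i : nat) := w i / (2 * dB).

Lemma J_pos : 0 < INR J. Proof. now apply lt_0_INR. Qed.
Lemma P_pos : 0 < INR P.
Proof. apply lt_0_INR. unfold P. nia. Qed.
Lemma dB_pos : 0 < dB.
Proof. unfold dB. pose proof P_pos. apply Rdiv_lt_0_compat; lra. Qed.
Lemma rho_pos i : 0 < rho i.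
Proof. apply Rmult_lt_0_compat; [auto|apply exp_pos]. Qed.
Lemma w_pos i : 0 < w i.
Proof. apply Rdiv_lt_0_compat; [apply rho_pos|apply J_pos]. Qed.
Lemma k_pos i : 0 < k i.
Proof. apply Rdiv_lt_0_compat; [apply w_pos|pose proof dB_pos; lra]. Qed.

Lemma rho_top i : (i <= P)%nat -> rho i <= top.
Proof.
  intros Hi. unfold rho, top. apply Rmult_le_compat_l; [lra|]. apply exp_le_compat.
  pose proof J_pos. apply Rmult_le_reg_r with (INR J); auto.
  unfold Rdiv. rewrite Rmult_assoc, Rinv_l, Rmult_1_r, <- mult_INR by lra. now apply le_INR.
Qed.

Lemma w_top i : (i <= P)%nat -> w i <= top / INR J.
Proof.
  intros Hi. apply Rmult_le_compat_r; [left; apply Rinv_0_lt_compat, J_pos|]. now apply rho_top.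
Qed.

(** By [exp x >= 1 + x], the geometric spacing of the squares makes each layer at least as thick as
    its cells are long. *)
Lemma rho_step i : w i <= rho (S i) - rho i.
Proof.
  unfold w, rho. rewrite S_INR. pose proof J_pos.
  replace ((INR i + 1) / INR J) with (INR i / INR J + / INR J) by (field; lra).
  rewrite exp_plus. pose proof (exp_ineq1_le (/ INR J)). pose proof (exp_pos (INR i / INR J)).
  unfold Rdiv at 1.
  assert (0 < rho0 * exp (INR i / INR J)) by now apply Rmult_lt_0_compat.
  nra.
Qed.

(** The triple consists of a side, a bin on that side and a time slab of length [tau]; the last
    condition is the speed that a fast crossing guarantees. *)
Definition incell (i : nat) (c : nat * nat * nat) (y : R) : Prop :=
  Rabs y <= b /\ exists t p, reaches f G M N y t p /\
    onside (rho i) (w i) (fst (fst c)) (snd (fst c)) p /\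
    INR (snd c) * tau <= t <= (INR (snd c) + 1) * tau /\ k i <= Cmod (f p).

(** The quotient [w i / k i] equals [2 * dB] in every layer, so the bound of [separation] is the
    same [h] at all scales. This scale invariance is where the geometry of the plane enters. *)
Lemma incell_close i c y1 y2 : (i <= P)%nat -> incell i c y1 -> incell i c y2 -> Rabs (y1 - y2) <= h.
Proof.
  intros Hi (Hy1 & t1 & p1 & R1 & S1 & T1 & K1) (Hy2 & t2 & p2 & R2 & S2 & T2 & K2).
  pose proof (exp_pos (K * N)). pose proof (w_top i Hi). pose proof (w_pos i). pose proof dB_pos.
  replace h with (3 * V / m * (w i / k i)).
  2:{ unfold h, k. field. repeat split; lra. }
  assert (exp (K * N) * w i <= exp (K * N) * (top / INR J)) by (apply Rmult_le_compat_l; lra).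
  apply (separation f F G z0 r b s m V HF Hs Hm HB HFG M K D HK Hf1 Hf2 N HN y1 y2 t1 t2 p1 p2 (k i) (w i)); auto.
  (* Times in one slab differ by at most [tau], and [V * tau = s / 2]. *)
  - apply Rle_lt_trans with (V * tau).
    + apply Rmult_le_compat_l; [lra|]. apply Rabs_le. lra.
    + unfold tau. replace (V * (s / (2 * V))) with (s / 2) by (field; lra). lra.
  - eapply onside_close; eassumption.
  - lra.
  - eapply Rle_trans; [|exact HJ2]. apply Rmult_le_compat_r; [lra|]. apply Rmult_le_compat_l; lra.
  - apply k_pos.
Qed.

Lemma center_exists (c : nat * (nat * nat * nat)) : exists x, (fst c <= P)%nat ->
  forall y, incell (fst c) (snd c) y -> Rabs (y - x) <= h.
Proof.
  destruct (classic (exists x, incell (fst c) (snd c) x)) as [[x Hx]|Hn].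
  - exists x. intros Hc y Hy. eapply incell_close; eassumption.
  (* An empty cell receives the arbitrary centre 0. *)
  - exists 0. intros _ y Hy. exfalso. eauto.
Qed.

Definition cells : list (nat * nat * nat) :=
  list_prod (list_prod (seq 0 4) (seq 0 (2 * J + 1))) (seq 0 Kt).

Lemma cells_length : length cells = (4 * (2 * J + 1) * Kt)%nat.
Proof. unfold cells. rewrite !length_prod, !length_seq. reflexivity. Qed.

Definition centers (x : nat * (nat * nat * nat) -> R) (n : nat) : list R :=
  flat_map (fun i => map (fun c => x (i, c)) cells) (seq 0 n).

Lemma centers_length x n : length (centers x n) = (n * (4 * (2 * J + 1) * Kt))%nat.
Proof.
  unfold centers. rewrite (flat_map_constant_length (c := (4 * (2 * J + 1) * Kt)%nat)).
  - now rewrite length_seq.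
  - intros i _. now rewrite length_map, cells_length.
Qed.

(** The times are the first hits of the successive squares, so that the trajectory stays inside each
    square until then. *)
Lemma crossing_times y : Rabs y <= b -> blows_up_by y ->
  exists (z : R -> C) (t : nat -> R), z 0 = G y /\ 
    (forall i, 0 < t i <= N /\ flows f z (t i) /\ t i < t (S i) /\ supnorm (z (t i)) = rho i /\
      forall u, 0 <= u <= t i -> supnorm (z u) <= rho i).
Proof.
  intros Hy (beta & z & Hbeta & Hz0 & Hz & Hblow).
  assert (Hhit : forall i, exists t, 0 < t < beta /\ supnorm (z t) = rho i /\
     forall u, 0 <= u < t -> supnorm (z u) < rho i).
  { intros i. destruct (Hblow (2 * rho i)) as [T [HT HTA]].
    destruct (first_hit (fun u => supnorm (z u)) T (rho i)) as (t & T1 & T2 & T3).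
    - lra.
    - rewrite Hz0. eapply Rle_lt_trans; [apply supnorm_le_Cmod|]. eapply Rlt_le_trans; [apply HG, Hy|].
      unfold rho. rewrite <- (Rmult_1_r rho0) at 1. apply Rmult_le_compat_l; [lra|].
      rewrite <- exp_0. apply exp_le_compat. apply Rmult_le_pos; [apply pos_INR|].
      left; apply Rinv_0_lt_compat, J_pos.
    - pose proof (Cmod_le_supnorm (z T)). lra.
    - intros u Hu e He. destruct (rder_cont z u _ (Hz u ltac:(lra)) e He) as [d [Hd Kd]].
      exists d; split; auto. intros v Hv. eapply Rle_lt_trans; [apply supnorm_lip|]. auto.
    - exists t. repeat split; auto; lra. }
  destruct (choice _ Hhit) as [t Ht]. exists z, t. split; auto. intros i.
  destruct (Ht i) as (T1 & T2 & T3). destruct (Ht (S i)) as (T1' & T2' & T3').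
  pose proof (rho_step i). pose proof (w_pos i).
  assert (Hle : forall u, 0 <= u <= t i -> supnorm (z u) <= rho i).
  { intros u Hu. destruct (Req_dec u (t i)) as [->|]; [lra|]. left; apply T3; lra. }
  split; [lra|split; [|split; [|auto]]].
  - intros u Hu. apply Hz. lra.
  - apply Rnot_le_lt. intros Hn. specialize (Hle (t (S i)) ltac:(lra)). lra.
Qed.

Lemma fast_crossing_in_cell y z t i : Rabs y <= b -> z 0 = G y -> (i < P)%nat ->
  (forall i, 0 < t i <= N /\ flows f z (t i) /\ t i < t (S i) /\ supnorm (z (t i)) = rho i /\
      forall u, 0 <= u <= t i -> supnorm (z u) <= rho i) ->
  t (S i) - t i <= dB -> exists c, In c cells /\ incell i c y.
Proof.
  intros Hy Hz0 Hi Ht Hfast.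
  assert (HMz : forall j, (j <= P)%nat -> forall u, 0 <= u <= t j -> Cmod (z u) < M).
  { intros j Hj u Hu. pose proof (Cmod_le_supnorm (z u)). pose proof (rho_top j Hj).
    destruct (Ht j) as (_ & _ & _ & _ & T). specialize (T u Hu). lra. }
  destruct (Ht i) as (T1 & T2 & T3 & T4 & T5).
  destruct (Ht (S i)) as (T1' & T2' & _ & T4' & _).
  assert (Hsp : k i <= Cmod (f (z (t i)))).
  { apply (fast_step f M K D HK Hf1 z (t i) (t (S i))); auto.
    - intros u Hu. split; [apply T2'; lra|apply (HMz (S i)); [lia|lra]].
    - eapply Rle_trans; [apply rho_step|]. rewrite <- T4, <- T4'.
      eapply Rle_trans; [apply Rle_abs|apply supnorm_lip]. }
  destruct (onside_exists (rho i) J (z (t i)) (rho_pos i) HJ T4) as (sd & bn & C1 & C2 & C3).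
  assert (Htau : 0 < tau) by (apply Rdiv_lt_0_compat; lra).
  assert (Hbin : exists kt, (kt < Kt)%nat /\ INR kt * tau <= t i <= (INR kt + 1) * tau).
  (* Since [bin_exists] may return one bin too many, it is applied with [Kt - 1] slabs, and later
     times go to the last slab. *)
  { destruct Kt as [|n]; [simpl in HKt; lra|].
    rewrite S_INR in HKt.
    destruct (Rle_dec (t i) (INR n * tau)) as [H|H].
    - destruct (bin_exists n tau (t i)) as [kt [H1 H2]]; auto; [lra|]. exists kt; split; [lia|auto].
    - exists n. split; [lia|lra]. }
  destruct Hbin as (kt & Kb & Kt2).
  exists ((sd, bn), kt). split.
  - unfold cells. apply in_prod; [apply in_prod|]; apply in_seq; lia.
  - split; auto. exists (t i), (z (t i)). split; [|auto].
    exists z. split; [lra|split; [auto|split; [auto|split; [apply HMz; lia|auto]]]].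
Qed.

(** A fast crossing adds at least 1 to the count; for a slow one [1 - (t (S n) - t n) / dB] is
    negative. Summing this lower bound over the layers telescopes. *)
Lemma centers_count x y z t n :
  (forall c, (fst c <= P)%nat -> forall y, incell (fst c) (snd c) y -> Rabs (y - x c) <= h) ->
  Rabs y <= b -> z 0 = G y -> (n <= P)%nat ->
  (forall i, 0 < t i <= N /\ flows f z (t i) /\ t i < t (S i) /\ supnorm (z (t i)) = rho i /\
      forall u, 0 <= u <= t i -> supnorm (z u) <= rho i) ->
  INR n - (t n - t 0%nat) / dB <= cover_count h y (centers x n).
Proof.
  intros Hx Hy Hz0 Hn Ht. pose proof dB_pos as Hd.
  induction n as [|n IH].
  - simpl. unfold Rdiv. rewrite Rminus_diag, Rmult_0_l. lra.
  - specialize (IH ltac:(lia)). unfold centers in *. rewrite seq_S, flat_map_app, cover_count_app.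
    simpl flat_map at 2. rewrite app_nil_r.
    assert (1 - (t (S n) - t n) / dB <= cover_count h y (map (fun c => x (n, c)) cells)).
    { destruct (Rle_dec (t (S n) - t n) dB) as [Hf|Hs'].
      - destruct (fast_crossing_in_cell y z t n Hy Hz0 ltac:(lia) Ht Hf) as (c & Hc & Hin).
        assert (0 <= (t (S n) - t n) / dB).
        { apply Rmult_le_pos; [|left; now apply Rinv_0_lt_compat]. destruct (Ht n) as (_ & _ & H & _). lra. }
        pose proof (cover_count_ge1 h y (map (fun c => x (n, c)) cells) (x (n, c))
          (in_map (fun c => x (n, c)) _ _ Hc) (Hx (n, c) ltac:(simpl; lia) y Hin)). lra.
      - pose proof (cover_count_ge0 h y (map (fun c => x (n, c)) cells)).
        assert (1 <= (t (S n) - t n) / dB); [|lra].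
        apply Rmult_le_reg_r with dB; auto. unfold Rdiv. rewrite Rmult_assoc, Rinv_l by lra. lra. }
    rewrite S_INR.
    replace ((t (S n) - t 0%nat) / dB) with ((t n - t 0%nat) / dB + (t (S n) - t n) / dB) by (field; lra).
    simpl Nat.add. lra.
Qed.

Lemma scale_cover : exists l, INR (length l) = INR P * (4 * (2 * INR J + 1) * INR Kt) /\
  forall y, Rabs y <= b -> blows_up_by y -> INR P / 2 <= cover_count h y l.
Proof.
  destruct (choice _ center_exists) as [x Hx].
  exists (centers x P). split.
  - rewrite centers_length, !mult_INR, plus_INR, mult_INR. simpl. ring.
  - intros y Hy Hb. destruct (crossing_times y Hy Hb) as (z & t & Hz0 & Ht).
    eapply Rle_trans; [|apply (centers_count x y z t P); auto].
    destruct (Ht P) as (T1 & _). destruct (Ht 0%nat) as (T2 & _). pose proof dB_pos. pose proof P_pos.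
    (* All crossings together last at most [N], which is [INR P / 2 * dB] by the choice of [dB]. *)
    assert ((t P - t 0%nat) / dB <= INR P / 2); [|lra].
    apply Rmult_le_reg_r with dB; auto. unfold Rdiv at 1. rewrite Rmult_assoc, Rinv_l by lra.
    replace (INR P / 2 * dB) with N by (unfold dB; field; lra). lra.
Qed.
End Scale.

(** The order of choices matters: [Kt] depends on [N] and [tau], [Q] on [e], then [K] on the largest
    square, hence on [Q], and [J] last on all of these. *)
Lemma escape_cover e : 0 < e -> exists l h a, 0 < h /\ 0 < a /\
  (forall y, Rabs y <= b -> blows_up_by y -> a <= cover_count h y l) /\
  INR (length l) * (2 * h) <= e * a.
Proof.
  intros He.
  set (tau := s / (2 * V)). assert (Htau : 0 < tau) by (apply Rdiv_lt_0_compat; lra).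
  destruct (INR_archimed tau N Htau) as [Kt HKt].
  assert (HKt0 : 0 < INR Kt) by nra.
  (* The total length of the intervals is [96 * (2 * INR J + 1) * (INR Kt * V * N / m)], at most
     [288 * INR J] times the last factor, that is, [INR J * Cst / 2]. *)
  set (Cst := 576 * INR Kt * V * N / m).
  assert (HCst : 0 < Cst) by (unfold Cst; apply Rdiv_lt_0_compat; auto; repeat apply Rmult_lt_0_compat; lra).
  destruct (INR_archimed e Cst He) as [Q HQ].
  assert (HQ0 : 0 < INR Q) by nra.
  assert (HQn : (0 < Q)%nat) by (apply INR_lt; exact HQ0).
  set (top := rho0 * exp (INR Q)).
  assert (Htop : 0 < top) by (apply Rmult_lt_0_compat; [auto|apply exp_pos]).
  destruct (entire_estimates f (2 * top + 1) Hent) as (K & D & HK & Hf1 & Hf2); [lra|].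
  set (X := exp (K * N) * top). assert (HX : 0 < X) by (apply Rmult_lt_0_compat; [apply exp_pos|auto]).
  assert (0 < K * X * N) by (apply Rmult_lt_0_compat; [apply Rmult_lt_0_compat|]; auto).
  assert (0 < K * N) by (apply Rmult_lt_0_compat; auto).
  (* The three summands are tailored to the three smallness conditions of [scale_cover], in their
     order; the minimum serves those with right-hand side [s] and those without. *)
  destruct (INR_archimed (Rmin s 1) (X + K * X * N + 4 * (K * N)) (Rmin_pos s 1 Hs Rlt_0_1)) as [J HJ].
  pose proof (Rmin_l s 1); pose proof (Rmin_r s 1). pose proof (Rmin_pos s 1 Hs Rlt_0_1).
  assert (HJ0 : 0 < INR J) by nra.
  assert (HJn : (0 < J)%nat) by (apply INR_lt; exact HJ0).
  assert (HJ1 : INR J * Rmin s 1 <= INR J * s) by (apply Rmult_le_compat_l; lra).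
  assert (HJ2 : INR J * Rmin s 1 <= INR J * 1) by (apply Rmult_le_compat_l; lra).
  assert (1 <= INR Q) by (change 1 with (INR 1); apply le_INR; lia).
  assert (1 <= INR J) by (change 1 with (INR 1); apply le_INR; lia).
  set (dB := 2 * N / INR (Q * J)).
  assert (HP : 0 < INR (Q * J)) by (rewrite mult_INR; now apply Rmult_lt_0_compat).
  assert (dB_pos : 0 < dB) by (apply Rdiv_lt_0_compat; lra).
  destruct (scale_cover (2 * top + 1) K D Q J Kt) as (l & L1 & L2); auto.
  - fold top; lra.
  - fold top. unfold Rdiv. rewrite <- Rmult_assoc. fold X.
    apply Rmult_le_reg_r with (INR J); auto. rewrite Rmult_assoc, Rinv_l by lra. lra.
  - fold top. replace (K * (exp (K * N) * (top / INR J)) * N) with (K * X * N / INR J) by (unfold X; field; lra).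
    apply Rmult_le_reg_r with (INR J); auto. unfold Rdiv. rewrite Rmult_assoc, Rinv_l by lra. lra.
  - fold dB. apply Rmult_le_reg_r with (INR (Q * J)); auto.
    replace (K * dB * INR (Q * J)) with (2 * (K * N)) by (unfold dB; field; lra).
    rewrite mult_INR. assert (INR J <= INR Q * INR J) by nra. lra.
  - fold tau. lra.
  - exists l, (3 * V / m * (2 * dB)), (INR (Q * J) / 2).
    split; [|split; [lra|split; [exact L2|]]].
    + apply Rmult_lt_0_compat; [apply Rdiv_lt_0_compat|]; lra.
    + rewrite L1. rewrite mult_INR in *.
      replace (INR Q * INR J * (4 * (2 * INR J + 1) * INR Kt) * (2 * (3 * V / m * (2 * dB))))
        with (96 * (2 * INR J + 1) * (INR Kt * V * N / m)) by (unfold dB; rewrite mult_INR; field; lra).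
      assert (E : 96 * (2 * INR J + 1) * (INR Kt * V * N / m) <= INR J * Cst / 2).
      { replace (INR J * Cst / 2) with (96 * (3 * INR J) * (INR Kt * V * N / m)) by (unfold Cst; field; lra).
        apply Rmult_le_compat_r; [|lra].
        apply Rmult_le_pos; [|left; now apply Rinv_0_lt_compat]. repeat apply Rmult_le_pos; lra. }
      eapply Rle_trans; [exact E|].
      assert (INR J * Cst <= INR J * (INR Q * e)) by (apply Rmult_le_compat_l; lra). lra.
Qed.
End Cover.

(** * Null sets *)

Module Meas.
From mathcomp Require Import all_boot all_order all_algebra.
From mathcomp Require Import all_classical all_reals all_analysis.
From mathcomp Require Import measurable_realfun.
From mathcomp Require Import Rstruct Rstruct_topology.
Import Order.TTheory GRing.Theory Num.Theory.
Local Open Scope classical_set_scope.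
Local Open Scope ring_scope.

(** Markov's inequality for the sum of the indicators, whose integral is the number of intervals
    times [2 * h]. *)
Lemma markov_intervals (R : realType) (h a : R) (l : seq R) : 0 < h -> 0 < a ->
  exists E : set R, [/\ measurable E,
    [set y | a <= \sum_(x <- l) \1_(`[x - h, x + h]%classic : set R) y] `<=` E &
    (a%:E * lebesgue_measure E <= ((size l)%:R * (2 * h))%:E)%E].
Proof.
move=> h0 a0.
pose gi (x y : R) : \bar R := (\1_(`[x - h, x + h]%classic : set R) y)%:E.
pose g (y : R) : \bar R := (\sum_(x <- l) gi x y)%E.
have mi (x : R) : measurable_fun setT (gi x).
  by apply/measurable_EFinP; apply: measurable_indic; exact: measurable_itv.
have gi0 x y : (0 <= gi x y)%E by rewrite /gi lee_fin.
have mg : measurable_fun setT g by apply: emeasurable_sum => x; exact: mi.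
have g0 y : (0 <= g y)%E by exact: sume_ge0.
exists (setT `&` [set y | (a%:E <= `|g y|)%E]); split.
- apply: emeasurable_fun_c_infty => //. exact: measurableT_comp.
- by move=> y /= ay; split => //; rewrite gee0_abs // /g sumEFin lee_fin.
- apply: (@le_trans _ _ (\int[lebesgue_measure]_x g x)%E).
    (* The general form of Markov's inequality, with the identity as weight function. *)
    have := @le_integral_comp_abse _ _ _ lebesgue_measure setT measurableT g a id (@measurable_id _ _ _)
      (fun r H => H) (fun x y _ _ H => H) mg a0.
    move/le_trans; apply. apply: ge0_le_integral => //.
    + exact: measurableT_comp.
    + by move=> x _ /=; rewrite gee0_abs.
  rewrite /g ge0_integral_sum //.
  have -> : (\sum_(k <- l) (\int[lebesgue_measure]_x gi k x) = \sum_(k <- l) (2 * h)%:E)%E.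
    apply: eq_bigr => x _.
    have -> : (\int[lebesgue_measure]_y gi x y)%E = lebesgue_measure (`[x - h, x + h]%classic : set R).
      by rewrite /gi integral_indic ?setIT //; exact: measurable_itv.
    rewrite lebesgue_measure_itv /= lte_fin.
    rewrite ltrBlDr -addrA ltrDl addr_gt0 // -EFinB; congr (_%:E).
    by rewrite opprB addrC addrA subrK mulr_natl mulr2n.
  by rewrite sumEFin big_const_seq count_predT iter_addr_0 [(size l)%:R * _]mulr_natl.
Qed.

(** Markov's inequality encloses [Y] in measurable sets of measure at most [1 / (n + 1)]; their
    intersection is null. *)
Lemma negligible_of_covers (R : realType) (Y : set R) :
  (forall e : R, 0 < e -> exists (l : seq R) (h a : R), [/\ 0 < h, 0 < a,
     forall y, Y y -> a <= \sum_(x <- l) \1_(`[x - h, x + h]%classic : set R) y &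
     (size l)%:R * (2 * h) <= e * a]) ->
  (@lebesgue_measure R).-negligible Y.
Proof.
move=> H.
have K (n : nat) : exists E : set R, [/\ measurable E, Y `<=` E &
    (lebesgue_measure E <= (n.+1%:R^-1)%:E)%E].
  have [l [h [a [h0 a0 Hl Hle]]]] := H (n.+1%:R^-1) ltac:(by rewrite invr_gt0 ltr0n).
  have [E [mE YE EE]] := @markov_intervals R h a l h0 a0.
  exists E; split => //.
    by move=> y Yy; apply: YE; exact: Hl.
  rewrite -(@lee_pmul2l _ a%:E) // ?lte_fin //.
  by apply: (le_trans EE); rewrite -EFinM lee_fin mulrC [a * _]mulrC mulrC.
have [E HE] := choice K.
have mcap : measurable (\bigcap_n E n) by apply: bigcapT_measurable => n; have [] := HE n.
exists (\bigcap_n E n); split => //.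
- apply/eqP; rewrite eq_le measure_ge0 andbT.
  apply/lee_addgt0Pr => e e0; rewrite add0e.
  have [n Hn] : exists n, n.+1%:R^-1 < e.
    exists (Num.truncn e^-1). rewrite invf_plt ?posrE ?ltr0n //. exact: truncnS_gt.
  have [mE YE EE] := HE n.
  apply: le_trans (le_trans EE _); last by rewrite lee_fin ltW.
  by apply: le_measure; rewrite ?inE //; exact: bigcap_inf.
- by move=> y Yy n _; have [_ + _] := HE n; apply.
Qed.

(** Links the decidable comparison of the standard reals with the indicator functions of measure
    theory. *)
Lemma cover_countE (h y : Rdefinitions.R) (l : seq Rdefinitions.R) :
  cover_count h y l = \sum_(x <- l) \1_(`[x - h, x + h]%classic : set Rdefinitions.R) y.
Proof.
elim: l => [|x l IH]; first by rewrite big_nil.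
rewrite big_cons -IH /= -RplusE; congr Rplus.
have E : (y \in (`[x - h, x + h]%classic : set Rdefinitions.R)) = (Rabs (y - x) <= h).
  by rewrite mem_setE in_itv /= RabsE ler_distl.
by rewrite indicE E; case: Rle_dec => [/RleP ->|/RleP/negbTE ->].
Qed.

Lemma lebesgue_null_of_covers (Y : Rdefinitions.R -> Prop) :
  (forall e, Rlt 0 e -> exists l h a, Rlt 0 h /\ Rlt 0 a /\
     (forall y, Y y -> Rle a (cover_count h y l)) /\
     Rle (Rmult (INR (length l)) (Rmult 2 h)) (Rmult e a)) ->
  lebesgue_null Y.
Proof.
move=> H; apply: (@negligible_of_covers Rdefinitions.R) => e /RltP /H [l [h [a [/RltP h0 [/RltP a0 [Hl /RleP Hle]]]]]].
exists l, h, a; split => //.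
- by move=> y Yy; rewrite -cover_countE; apply/RleP; exact: Hl.
- by move: Hle; rewrite INRE.
Qed.

Lemma lebesgue_null_union (Y : Rdefinitions.R -> Prop) (Yn : nat -> Rdefinitions.R -> Prop) :
  (forall y, Y y -> exists n, Yn n y) -> (forall n, lebesgue_null (Yn n)) -> lebesgue_null Y.
Proof.
move=> H Hn. apply: (negligibleS _ (negligible_bigcup Hn)) => y /H[n Yny].
by exists n.
Qed.
End Meas.

(** * Escaping trajectories *)

Lemma positive_lower_bound (p : R -> R) (b : R) :
  (forall y, Rabs y <= b -> 0 < p y /\ forall e, 0 < e -> exists d, 0 < d /\
     forall u, Rabs (u - y) < d -> Rabs (p u - p y) < e) ->
  exists m, 0 < m /\ forall y, Rabs y <= b -> m <= p y.
Proof.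
  intros H. destruct (Rle_dec 0 b) as [Hb|Hb].
  - destruct (continuity_ab_min p (- b) b) as [x [Hx Hx2]]; [lra| |].
    + intros y Hy. apply continuity_pt_filterlim, continuous_R_eps.
      apply H. apply Rabs_le. lra.
    + exists (p x). split; [apply H, Rabs_le; lra|].
      intros y Hy. apply Hx. now apply Rabs_le_between.
  (* For negative [b] no [y] qualifies, and any positive bound will do. *)
  - exists 1. split; [lra|]. intros y Hy. pose proof (Rabs_pos y). lra.
Qed.

Lemma continuous_curve_eps (G : R -> C) (y : R) : continuous G y ->
  forall e, 0 < e -> exists d, 0 < d /\ forall u, Rabs (u - y) < d -> Cmod (G u - G y) < e.
Proof.
  intros H e He.
  destruct (H (fun w => Cmod (w - G y) < e)) as [d Hd].
  - apply (locally_Cmod (G y) (fun w => Cmod (w - G y) < e)). exists e. split; auto.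
  - exists d. split; [apply cond_pos|]. intros u Hu. now apply Hd.
Qed.

Lemma Cmod_diff_le (a b : C) : Rabs (Cmod a - Cmod b) <= Cmod (a - b).
Proof.
  apply Rabs_le. pose proof (Cmod_minus_ge a b). pose proof (Cmod_minus_ge b a).
  rewrite (Cmod_minus_sym b a) in H0. lra.
Qed.

(** Compactness of the arc gives a positive lower bound [m] for the speed and [m2] for the distance
    to the circle of radius [r]; these yield the uniform constants demanded by [escape_cover]. *)
Lemma null_on_compact_arc (f F : C -> C) (G : R -> C) (z0 : C) (r b N : R) :
  (forall z, exists l, has_cderiv f z l) ->
  (forall z, Cmod (z - z0) < r -> f z <> 0%C /\ has_cderiv F z (/ f z)%C) ->
  (forall y, Rabs y <= b -> continuous G y /\ Cmod (G y - z0) < r /\ F (G y) = (0, y)) ->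
  0 < r -> 0 < N ->
  lebesgue_null (fun y => Rabs y <= b /\ blows_up_by f G N y).
Proof.
  intros Hf HF HG Hr HN.
  destruct (positive_lower_bound (fun y => Cmod (f (G y))) b) as [m [Hm Hmin]].
  { intros y Hy. destruct (HG y Hy) as (Gc & Gin & _). split; [apply Cmod_gt_0; now apply HF|].
    intros e He. destruct (Hf (G y)) as [l Hl].
    destruct (has_cderiv_ccont _ _ _ Hl e He) as [d1 [Hd1 K1]].
    destruct (continuous_curve_eps G y Gc d1 Hd1) as [d [Hd K]].
    exists d. split; auto. intros u Hu. eapply Rle_lt_trans; [apply Cmod_diff_le|]. auto. }
  destruct (positive_lower_bound (fun y => r - Cmod (G y - z0)) b) as [m2 [Hm2 Hmin2]].
  { intros y Hy. destruct (HG y Hy) as (Gc & Gin & _). split; [lra|].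
    intros e He. destruct (continuous_curve_eps G y Gc e He) as [d [Hd K]].
    exists d. split; auto. intros u Hu. specialize (K u Hu).
    replace (r - Cmod (G u - z0) - (r - Cmod (G y - z0))) with (Cmod (G y - z0) - Cmod (G u - z0)) by ring.
    eapply Rle_lt_trans; [apply Cmod_diff_le|].
    replace (G y - z0 - (G u - z0))%C with (G y - G u)%C by ring. now rewrite Cmod_minus_sym. }
  pose proof (Cmod_ge_0 z0) as Hz0.
  destruct (entire_estimates f (Cmod z0 + r) Hf) as (K & D & HK & Hf1 & Hf2); [lra|].
  assert (Hin : forall w, Cmod (w - z0) < r -> Cmod w < Cmod z0 + r).
  { intros w Hw. pose proof (Cmod_minus_ge w z0). lra. }
  (* The first bound keeps the [s]-neighbourhood of the arc in the disc; the second lets the speed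
     drop there by at most [m / 2], since [f] has Lipschitz constant [K]. *)
  set (s := Rmin (m2 / 2) (m / (2 * K))).
  assert (Hs : 0 < s) by (apply Rmin_pos; [lra|apply Rdiv_lt_0_compat; lra]).
  assert (Hs1 : s <= m2 / 2) by apply Rmin_l.
  assert (Hs2 : K * s <= m / 2).
  { assert (s <= m / (2 * K)) by apply Rmin_r. apply Rmult_le_compat_l with (r := K) in H; [|lra].
    replace (K * (m / (2 * K))) with (m / 2) in H by (field; lra). lra. }
  assert (HB : forall y w, Rabs y <= b -> Cmod (w - G y) <= s ->
    Cmod (w - z0) < r /\ m / 2 <= Cmod (f w) <= K).
  { intros y w Hy Hw. specialize (Hmin y Hy). specialize (Hmin2 y Hy). simpl in *.
    destruct (HG y Hy) as (_ & Gin & _).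
    assert (Hwr : Cmod (w - z0) < r).
    { replace (w - z0)%C with ((w - G y) + (G y - z0))%C by ring.
      eapply Rle_lt_trans; [apply Cmod_triangle|]. lra. }
    split; auto. split; [|now apply Hf1, Hin].
    destruct (Hf2 (G y) w (Hin _ Gin) (Hin _ Hwr)) as [L _].
    rewrite (Cmod_minus_sym (G y) w) in L.
    pose proof (Cmod_minus_ge (f (G y)) (f w)).
    assert (K * Cmod (w - G y) <= K * s) by (apply Rmult_le_compat_l; lra). lra. }
  apply Meas.lebesgue_null_of_covers. intros e He.
  destruct (escape_cover f F G z0 r b s (m / 2) K (Cmod z0 + r)) with (N := N) (e := e)
    as (l & h & a & Hh & Ha & Hc & Hl); auto; try lra.
  - intros z Hz. now apply HF.
  - intros y Hy. now apply HG.
  - intros y Hy. apply Hin. now apply HG.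
  - exists l, h, a. repeat split; auto. intros y [Hy1 Hy2]. now apply Hc.
Qed.

Lemma escapes_blows_up f G y : escapes_in_finite_time f (G y) ->
  exists beta, forall N, beta <= N -> blows_up_by f G N y.
Proof.
  intros (alpha & beta & z & Hab & Hz0 & Hz & Hinf).
  exists beta. intros N HN. exists beta, z. split; [lra|split; [auto|split]].
  - intros t Ht. apply is_derive_rder, Hz. lra.
  (* The maximum with 0 keeps the time nonnegative when [eta] is large compared with [beta]. *)
  - intros A. destruct (Hinf A) as [eta [He K]]. exists (Rmax 0 (beta - eta / 2)).
    pose proof (Rmax_l 0 (beta - eta / 2)); pose proof (Rmax_r 0 (beta - eta / 2)).
    assert (Rmax 0 (beta - eta / 2) < beta) by (apply Rmax_lub_lt; lra).
    split; [lra|]. apply K. lra.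
Qed.

Theorem theorem1p2
  (f : C -> C) (hf : transcendental_entire f)
  (z0 : C) (hz0 : f z0 <> RtoC 0)
  (* F(z) = \int_{z0}^{z} du / f(u) on the disc D(z0, r): the primitive of 1/f
     on the disc vanishing at z0 *)
  (r : R) (hr : 0 < r) (F : C -> C)
  (hfnz : forall z : C, Cmod (Cminus z z0) < r -> f z <> RtoC 0)
  (hF0 : F z0 = RtoC 0)
  (hF : forall z : C, Cmod (Cminus z z0) < r -> has_cderiv F z (Cinv (f z)))
  (* G y = F^{-1}(i y) for y in (-delta, delta): the branch of the local
     inverse of F through z0 *)
  (delta : R) (hdelta : 0 < delta) (G : R -> C)
  (hG0 : G 0 = z0)
  (hGcont : forall y : R, - delta < y < delta -> continuous G y)
  (hGin : forall y : R, - delta < y < delta -> Cmod (Cminus (G y) z0) < r)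
  (hFG : forall y : R, - delta < y < delta -> F (G y) = (0, y)) :
  lebesgue_null
    (fun y : R => - delta < y < delta /\ escapes_in_finite_time f (G y)).
Proof.
  (* The open arc is exhausted by compact arcs while the bound on the blow-up time grows. *)
  apply (Meas.lebesgue_null_union _ (fun n y =>
    Rabs y <= delta - delta / (INR n + 2) /\ blows_up_by f G (INR n + 1) y)).
  - intros y [Hy Hesc]. destruct (escapes_blows_up f G y Hesc) as [beta Hb].
    assert (Ha : Rabs y < delta) by (apply Rabs_def1; lra).
    (* One [n] serves both purposes: the inequality implies that [INR n] exceeds [Rabs beta] and
       that [delta / (INR n + 2)] is at most [delta - Rabs y]. *)
    destruct (INR_archimed (delta - Rabs y) (delta + Rabs beta * (delta - Rabs y))) as [n Hn]; [lra|].
    pose proof (Rle_abs beta).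
    exists n. split.
    + pose proof (pos_INR n). pose proof (Rabs_pos beta).
      assert (delta / (INR n + 2) <= delta - Rabs y); [|lra].
      apply Rmult_le_reg_r with (INR n + 2); [lra|].
      unfold Rdiv. rewrite Rmult_assoc, Rinv_l by lra. nra.
    + apply Hb. assert (Rabs beta <= INR n); [|lra].
      apply Rmult_le_reg_r with (delta - Rabs y); lra.
  - intros n. pose proof (pos_INR n).
    assert (Hd : 0 < delta / (INR n + 2)) by (apply Rdiv_lt_0_compat; lra).
    apply (null_on_compact_arc f F G z0 r); auto; try lra.
    + exact (proj1 hf).
    + intros y Hy. apply Rabs_le_between in Hy.
      assert (- delta < y < delta) by lra. auto.
Qed.
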